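(* Let $k_0>0$, let $g_{\mathrm{ini}}\in C([0,1];\mathbb{R}^+)$ satisfy $\int_0^1 x\,g_{\mathrm{ini}}(x)\,dx=1$, and let $T>1$ be arbitrary. Then there exists a unique mild solution on $[1,T]$ with initial data $g_{\mathrm{ini}}$ of the system $$\frac{\partial g}{\partial t}(t,x)=-\frac{k_0}{N(t)}g(t,x)g(t,t-x),\qquad N(t)=\int_0^t g(t,x)\,dx,\qquad \int_0^t x\,g(t,x)\,dx=1,$$ that is, there exists a unique $g\in X$ with $\Gamma[g]=g$, where the space $X$ and the operator $\Gamma$ are those defined in the context.
   Context: Here $\mathbb{R}^+=(0,\infty)$ and $\mathbb{R}_0^+=[0,\infty)$; $k_0>0$ is a constant. For $T>1$ let $\Omega=[1,T]\times[0,T]$, with points written $(t,x)$. Let $X$ be the space of all functions $g$ such that: (i) $g:\Omega\to\mathbb{R}_0^+$; (ii) $g(1,x)=g_{\mathrm{ini}}(x)$ for all $x\in[0,1)$; (iii) $g(t,x)=0$ if $x>t$; (iv) $g$ is continuous at all points $(t,x)\in\Omega$ with $x\neq1$ and $x\neq t$. For $g\in X$ set $N(t)=\int_0^t g(t,x)\,dx$ and $$B[g](t)=\frac{k_0}{2N(t)}\int_0^t g(t,x)\,g(t,t-x)\,dx,$$ and define $$\Gamma[g](t,x)=\begin{cases} g_{\mathrm{ini}}(x)\exp\left(-k_0\int_1^t\frac{g(s,s-x)}{N(s)}\,ds\right), & x<1,\\[4pt] B[g](x)\exp\left(-k_0\int_x^t\frac{g(s,s-x)}{N(s)}\,ds\right),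 & 1\le x\le t,\\[4pt] 0,& t<x.\end{cases}$$ The equation $\Gamma[g]=g$ is understood to include that these expressions make sense, i.e. $0<N(t)<\infty$ and $B[g](t)<\infty$ for all $t\in[1,T]$. A mild solution on $[1,T]$ is by definition an element $g\in X$ with $\Gamma[g]=g$. *)

(* Defs.v *)
From HB Require Import structures.
From mathcomp Require Import all_boot all_order all_algebra.
From mathcomp Require Import all_classical all_reals all_analysis.
Import Order.TTheory GRing.Theory Num.Theory.
Import numFieldNormedType.Exports.

Set Implicit Arguments.
Unset Strict Implicit.
Unset Printing Implicit Defensive.

Local Open Scope classical_set_scope.
Local Open Scope ring_scope.

Section MildSolution.
Context {R : realType}.

Notation mu := (@lebesgue_measure R).

Definition Omega (T : R) : set (R * R) := `[1, T] `*` `[0, T].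

(* A function on Omega is represented by a total function on R * R. Its values
   outside Omega are junk: no definition below reads them when 1 <= t <= T, so
   equality of such functions has to be understood on Omega only. *)

(* Continuity is relative to Omega, whence the filter [within (Omega T) _]. *)
Definition in_X (gini : R -> R) (T : R) (g : R * R -> R) : Prop :=
  [/\ forall p, Omega T p -> 0 <= g p,
      forall x, 0 <= x < 1 -> g (1, x) = gini x,
      forall t x, Omega T (t, x) -> t < x -> g (t, x) = 0 &
      forall t x, Omega T (t, x) -> x != 1 -> x != t ->
        g @ within (Omega T) (nbhs (t, x)) --> g (t, x)].

Definition N (g : R * R -> R) (t : R) : \bar R :=
  (\int[mu]_(x in `[0%R, t]) (g (t, x))%:E)%E.

(* [fine] is only meaningful when 0 < N g t < +oo, which [mild_solution]
   requires. *)
Definition B (k0 : R) (g : R * R -> R) (t : R) : \bar R :=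
  ((k0 / (2 * fine (N g t)))%:E *
   \int[mu]_(x in `[0%R, t]) (g (t, x) * g (t, t - x))%:E)%E.

(* exp (- k0 * \int_a^t g(s, s - x) / N(s) ds), with exp (-oo) = 0 *)
Definition decay (k0 : R) (g : R * R -> R) (a t x : R) : \bar R :=
  expeR (- (k0%:E *
    \int[mu]_(s in `[a, t]) (g (s, s - x) / fine (N g s))%:E))%E.

Definition Gamma (k0 : R) (gini : R -> R) (g : R * R -> R) (t x : R) : \bar R :=
  if x < 1 then ((gini x)%:E * decay k0 g 1 t x)%E
  else if x <= t then (B k0 g x * decay k0 g x t x)%E
  else 0%E.

Definition mild_solution (k0 : R) (gini : R -> R) (T : R) (g : R * R -> R)
    : Prop :=
  [/\ in_X gini T g,
      forall t, 1 <= t <= T -> (0 < N g t < +oo)%E /\ (B k0 g t < +oo)%E &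
      forall t x, Omega T (t, x) -> Gamma k0 gini g t x = (g (t, x))%:E].

End MildSolution.

(* Main.v *)
Require Import Defs.
From HB Require Import structures.
From mathcomp Require Import all_boot all_order all_algebra.
From mathcomp Require Import all_classical all_reals all_analysis.
From mathcomp Require Import measurable_realfun lra ring.
Import Order.TTheory GRing.Theory Num.Theory.
Import numFieldNormedType.Exports.
Set Implicit Arguments.
Unset Strict Implicit.
Unset Printing Implicit Defensive.
Local Open Scope classical_set_scope.
Local Open Scope ring_scope.

(** Fix the initial data and write [evolve] for the operator [Gamma] on real
    functions that vanish outside the triangle [wedge] of points with
    1 <= t <= T and 0 <= x <= t. The mild solution is its unique fixed point,
    and it comes from a contraction argument on a suitable class of functions.

    The class, [admissible nu], asks for continuity off the line x = 1, for
    the bound g(t, x) <= cap x with cap x = K e^{2 k0 x}, and for N >= nu.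

    - [evolve] preserves the bound by [cap] ([newborn_cap]): in
      the integral of g(t,x) g(t,t-x) one of the two sizes is at most t/2, so
      the integrand is at most cap(t/2) (g(t,x) + g(t,t-x)). The integral of
      the bracket is 2 N(t), hence B(t) <= k0 cap(t/2), and
      k0 cap(t/2) <= cap(t) for t >= 1.
    - It makes N at least [pop_floor] ([evolve_population_ge]). The
      particles present at time 1 lose, in the exponent, a total of k0 times
      the integral over x in [0,1[ and s in [1,t] of g(s,s-x)/N(s); integrating
      in x first bounds it by k0 (t - 1) whatever g is ([loss_rate_mass]), and
      by convexity of exp a bounded total exponent leaves a definite part of
      the initial population.
    - It halves distances in the sup norm weighted by e^{lam t + kap x}
      ([evolve_contraction]). The birth term B(x) only integrates over sizes
      below x, which gains a factor 1/kap; the loss exponent integrates over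
      times before t, which gains a factor 1/lam. First kap, then lam, is
      taken large.

    Picard iteration therefore converges to an admissible fixed point
    ([evolve_fixed_exists]), and such a fixed point is a mild solution
    ([fixed_mild]).

    For uniqueness it is enough that every mild solution h, cut to the wedge,
    is admissible for some nu > 0 ([mild_admissible]). The bound by [cap]
    follows from the doubling step B(x) <= k0 cap(x/2) by induction on the
    dyadic scale of x ([trim_capped]). Then N is continuous and positive on
    the compact interval [1,T], hence bounded below ([trim_population]).
    Continuity up to the diagonal x = t comes from the equation, as the loss
    exponent is of order t - x for x >= 1 ([trim_diag_cont]). *)

(** * Integrals of dominated functions *)

Section Tools.
Context {R : realType}.
Notation mu := (@lebesgue_measure R).
Implicit Types (f g : R -> R) (a b c C t x : R).

(** The common domination hypothesis: it allows every integral to be taken over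
    the whole line, whatever interval the integrand lives on. *)
Definition bsupp a C f := forall x, `|f x| <= C * \1_(`[0, a]) x.

Lemma bsuppI a C f : 0 <= C -> (forall x, 0 <= x <= a -> `|f x| <= C) ->
  (forall x, ~~ (0 <= x <= a) -> f x = 0) -> bsupp a C f.
Proof.
move=> C0 fC f0 x; rewrite indicE mem_setE in_itv/=.
have [/fC|/f0 ->] := boolP (0 <= x <= a); first by rewrite mulr1.
by rewrite normr0 mulr0.
Qed.

Lemma integrable_indic_itv0 a C :
  mu.-integrable setT (fun x => (C * \1_(`[0, a]) x)%:E).
Proof.
apply: eq_integrable (integrableZl measurableT C (integrable_indic_itv 0 a true false)) => //.
Qed.

Lemma bsupp_integrable a C f : measurable_fun setT f -> bsupp a C f ->
  mu.-integrable setT (EFin \o f).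
Proof.
move=> mf bf; apply: le_integrable (integrable_indic_itv0 a C) => //.
- exact/measurable_EFinP.
- by move=> x _ /=; rewrite lee_fin (le_trans (bf x))// ler_norm.
Qed.

(** A finite set of exceptional points is negligible, and the functions at hand
    are discontinuous along finitely many lines only. *)
Lemma dominated_cvg_off (S : seq R) a C (u : nat -> R -> R) f :
  (forall n, measurable_fun setT (u n)) -> measurable_fun setT f ->
  (forall n, bsupp a C (u n)) ->
  (forall x, x \notin S -> u n x @[n --> \oo] --> f x) ->
  (\int[mu]_x u n x)%R @[n --> \oo] --> (\int[mu]_x f x)%R.
Proof.
move=> mu_ mf bu cu.
have S0 : mu [set` S] = 0%E.
  exact/countable_lebesgue_measure0/finite_set_countable/finite_seq.
have [||intf _ h] := @dominated_convergence _ _ _ mu setT measurableT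
  (fun n => EFin \o u n) (EFin \o f)
  (fun x => (C * \1_(`[0, a]) x)%:E)
  (fun n => proj2 (measurable_EFinP _ _) (mu_ n))
  (proj2 (measurable_EFinP _ _) mf) _
  (integrable_indic_itv0 a C) _.
- exists [set` S]; split=> //; first exact/countable_measurable/finite_set_countable/finite_seq.
  move=> x /= nx; apply/negP => xS; apply: nx => _.
  by apply: cvg_EFin; [apply: nearW|exact/cu/negP].
- by apply: aeW => x n _ /=; rewrite lee_fin; exact: bu.
- apply: fine_cvg; rewrite fineK; first exact: h.
  exact: integrable_fin_num.
Qed.

(** * The reflection x |-> t - x *)

Lemma measurable_reflect t : measurable_fun [set: R] (fun x => t - x).
Proof. by apply: measurable_funB => //; exact: measurable_cst. Qed.

(** The reflection with its source and target as measurable types, which the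
    transfer theorem for pushforward measures has to infer. *)
Definition mirror t : measurableTypeR R -> measurableTypeR R := fun x => t - x.

Lemma lebesgue_measure_reflect t (A : set (measurableTypeR R)) : measurable A ->
  pushforward mu (mirror t) A = mu A.
Proof.
move=> mA; apply/esym/lebesgue_measure_unique => //=.
  exact: measurable_reflect.
move=> _ _ [[u v]] _ <-.
rewrite /pushforward (_ : mirror t @^-1` _ = `[t - v, t - u[%classic); last first.
  apply/seteqP; split => x; rewrite /mirror /= !in_itv/= => /andP[h1 h2]; apply/andP; split; lra.
rewrite !lebesgue_measure_itv/= !lte_fin.
by rewrite ltrD2l ltrN2; case: ifP => // _; rewrite -!EFinB; congr EFin; lra.
Qed.

Lemma ge0_integral_reflect (h : R -> \bar R) t : measurable_fun setT h ->
  (forall x, 0 <= h x)%E ->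
  (\int[mu]_x h (t - x)%R = \int[mu]_x h x)%E.
Proof.
move=> mf f0.
have := @ge0_integral_pushforward _ _ _ _ _ (mirror t) (measurable_reflect t) mu setT h.
rewrite preimage_setT => /(_ measurableT mf (fun x _ => f0 x)) <-.
apply: eq_measure_integral; first exact: measurable_reflect.
by move=> ? A mA _; exact: lebesgue_measure_reflect.
Qed.

Lemma Rintegral_reflect a C f t : measurable_fun setT f -> bsupp a C f ->
  bsupp a C (fun x => f (t - x)) ->
  \int[mu]_x f (t - x) = \int[mu]_x f x.
Proof.
move=> mf bf bf'; rewrite /Rintegral; congr fine.
have mr : measurable_fun setT (fun x => f (t - x)).
  exact: measurableT_comp (measurable_reflect t).
have mE : measurable_fun setT (EFin \o f) by exact/measurable_EFinP.
have := @integral_pushforward _ _ _ _ _ (mirror t) (measurable_reflect t) mu setT (EFin \o f) mE.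
rewrite preimage_setT => /(_ (bsupp_integrable mr bf') measurableT) <-.
apply: eq_measure_integral; first exact: measurable_reflect.
by move=> ? A mA _; exact: lebesgue_measure_reflect.
Qed.

(** * Continuity and measurability *)

Lemma measurable_off_finite (S : seq R) f :
  (forall x, x \notin S -> {for x, continuous f}) -> measurable_fun setT f.
Proof.
move=> cf; have cS : closed [set` S] by apply: (iffLR accessible_finite_set_closed); [exact: hausdorff_accessible|exact: finite_seq].
rewrite -(setvU [set` S]).
apply/measurable_funU.
- by apply: open_measurable; exact: closed_openC.
- exact/countable_measurable/finite_set_countable/finite_seq.
split.
  apply: open_continuous_measurable_fun; first exact: closed_openC.
  by move=> x /set_mem/= /negP/cf.
move=> _ A mA; apply: countable_measurable => //.
apply: finite_set_countable; apply: sub_finite_set (finite_seq S).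
exact: subIsetl.
Qed.

(** If f does not converge, some set of bad points meets every member of F, in
    particular every [D n], and a choice of bad points is a sequence that
    contradicts the hypothesis. The smaller the sets [D n], the fewer sequences
    there are to test. *)
Lemma cvg_seq_filter (T : Type) (F : set_system T) (FF : Filter F)
    (D : nat -> set T) (f : T -> R) (l : R) :
  (forall n, F (D n)) ->
  (forall u : nat -> T, (forall n, D n (u n)) -> f (u n) @[n --> \oo] --> l) ->
  f y @[y --> F] --> l.
Proof.
move=> FD h; apply/cvgrPdist_lt => e e0.
apply: contrapT => nF.
have /choice[u hu] : forall n, exists y, D n y /\ e <= `|l - f y|.
  move=> n; apply: contrapT => /forallNP nx; apply: nF.
  apply: filterS (FD n) => y Dy; rewrite ltNge; apply/negP => ey.
  exact: (nx y).
have /cvgrPdist_lt/(_ e e0)[N _ hN] := h u (fun n => (hu n).1).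
by have := hN N (leqnn N); rewrite /= ltNge (hu N).2.
Qed.

Lemma cvg_dist_invS (u : nat -> R) (x : R) :
  (forall n, `|x - u n| < n.+1%:R^-1) -> u n @[n --> \oo] --> x.
Proof.
move=> h; apply/cvgrPdist_lt => e e0; near=> n.
by apply: lt_trans (h n) _; near: n; exact: near_infty_natSinv_lt (PosNum e0).
Unshelve. all: by end_near. Qed.

Lemma cvg_seqP (f : R -> R) (x : R) :
  (forall u : nat -> R, u n @[n --> \oo] --> x ->
    f (u n) @[n --> \oo] --> f x) -> {for x, continuous f}.
Proof.
move=> h.
apply: (@cvg_seq_filter R (nbhs x) _ (fun n => ball x (n.+1%:R^-1 : R))) => [n|u hu].
  by apply: nbhsx_ballx; rewrite invr_gt0.
by apply: h; exact: cvg_dist_invS.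
Qed.

(** The condition relative to [D] is handled by sequences that stay in [D]:
    no filter has then to be transported through a change of variables. *)
Lemma cvg_seq_within (D : set (R * R)) (f : R * R -> R) (p : R * R) (l : R) :
  (forall u v : nat -> R, (forall n, D (u n, v n)) -> u n @[n --> \oo] --> p.1 ->
    v n @[n --> \oo] --> p.2 -> f (u n, v n) @[n --> \oo] --> l) ->
  f q @[q --> within D (nbhs p)] --> l.
Proof.
move=> h.
apply: (@cvg_seq_filter _ _ _ (fun n => D `&` ball p (n.+1%:R^-1 : R))) => [n|u hu].
  have : nbhs p (ball p (n.+1%:R^-1 : R)) by apply: nbhsx_ballx; rewrite invr_gt0.
  by rewrite /within/=; apply: filterS => x px Dx.
have -> : (fun n => f (u n)) = (fun n => f ((u n).1, (u n).2)).
  by apply/funext => n; case: (u n).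
apply: h => [n||].
- by have [] := hu n; case: (u n).
- by apply: cvg_dist_invS => n; have [_ []] := hu n.
- by apply: cvg_dist_invS => n; have [_ []] := hu n.
Qed.

(** Both the topology and the sigma-algebra of the plane are products, and they
    match because an open set is a countable union of rational boxes. *)
Lemma open_measurable_prod (U : set (R * R)) : open U -> measurable U.
Proof.
move=> oU.
pose box (q : (rat * rat) * rat) : set (R * R) :=
  ball (ratr q.1.1 : R) (ratr q.2 : R) `*` ball (ratr q.1.2 : R) (ratr q.2 : R).
have -> : U = \bigcup_(q in [set q | box q `<=` U]) box q.
  apply/seteqP; split=> [[x y] Uxy|z [q /= qU /qU//]].
  have /nbhs_ballP[e /= e0 eU] : nbhs (x, y) U by exact: open_nbhs_nbhs.
  have [r /= re] : exists r : rat, 0 < (ratr r : R) < e / 2.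
    have := @rat_in_itvoo R 0 (e / 2) (divr_gt0 e0 (ltr0n _ 2)).
    by move=> [r]; rewrite in_itv/=; exists r.
  have /andP[r0 re2] := re.
  have [p] := @rat_in_itvoo R (x - ratr r) (x + ratr r) ltac:(by lra).
  have [q] := @rat_in_itvoo R (y - ratr r) (y + ratr r) ltac:(by lra).
  rewrite !in_itv/= => /andP[q1 q2] /andP[p1 p2].
  exists ((p, q), r); last by split; rewrite /ball/= ltr_norml; lra.
  move=> [x' y'] [/= h1 h2]; apply: eU.
  move: h1 h2; rewrite /ball/= !ltr_norml => /andP[h1 h2] /andP[h3 h4].
  by split; rewrite /ball/= ltr_norml; lra.
have cq : countable [set: (rat * rat) * rat] by exact: countableP.
rewrite bigcup_mkcond; apply: countable_bigcupT_measurable => // q.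
by case: ifPn => // _; apply: measurableX; exact: measurable_ball.
Qed.

Lemma closed_measurable_prod (U : set (R * R)) : closed U -> measurable U.
Proof.
move=> cU; rewrite -(setCK U); apply: measurableC.
by apply: open_measurable_prod; exact: closed_openC.
Qed.

Lemma measurable_fun_within (D : set (R * R)) (f : R * R -> R) :
  measurable D -> (forall p, D p -> f q @[q --> within D (nbhs p)] --> f p) ->
  measurable_fun D f.
Proof.
move=> mD cf; apply: (measurability _ (RGenOpens.measurableE R)).
move=> _ [_ [a [b ->] <-]].
pose V : set (R * R) := [set p | exists2 W, open_nbhs p W & D `&` W `<=` f @^-1` `]a, b[].
have -> : D `&` f @^-1` `]a, b[ = D `&` V.
  apply/seteqP; split=> p [Dp].
    move=> fp; split=> //; rewrite /V/=.
    have : nbhs (f p) `]a, b[%classic by apply: near_in_itvoo.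
    move=> /(cf p Dp) h.
    have : nbhs p [set q | D q -> f q \in `]a, b[] by exact: h.
    rewrite nbhsE => -[W oW sW]; exists W => //.
    by move=> x [Dx Wx]; exact: sW.
  by move=> [W oW sW]; split => //; apply: sW; split => //; by case: oW.
apply: measurableI => //; apply: open_measurable_prod.
rewrite openE => p [W [oW Wp] sW].
rewrite /interior nbhsE; exists W => // x Wx.
by exists W.
Qed.

Lemma measurable_funV (d : measure_display) (X : measurableType d) (f : X -> R) : measurable_fun setT f ->
  measurable_fun setT (fun z => (f z)^-1).
Proof.
move=> mf; apply: (measurableT_comp _ mf).
apply: (@measurable_off_finite [:: 0]) => x; rewrite inE => x0.
exact: inv_continuous.
Qed.

(** * Exponential weights *)

Lemma integral_expR k a : 0 < k -> 0 <= a ->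
  \int[mu]_(x in `[0, a]) expR (k * x) = (expR (k * a) - 1) / k.
Proof.
move=> k0; rewrite le_eqVlt => /predU1P[<-|a0].
  by rewrite set_itv1 Rintegral_set1 mulr0 expR0 subrr mul0r.
pose F : R -> R := k^-1 \*: (expR \o ( *%R k)).
have dF (x : R) : is_derive x 1 F (expR (k * x)).
  have h : is_derive x 1 ( *%R k : R -> R) k.
    by rewrite -[X in is_derive _ _ _ X]mulr1; apply: is_deriveZ.
  have h2 := @is_deriveZ _ _ _ _ k^-1 _ _ _ (is_derive1_comp (is_derive_expR (k * x)) h).
  apply: is_derive_eq h2 _.
  by rewrite /GRing.scale/= mulrC -mulrA divff ?mulr1// gt_eqF.
have cE : continuous (fun x : R => expR (k * x)).
  by move=> x; apply: continuous_comp; [exact: mulrl_continuous|exact: continuous_expR].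
have cF : continuous F.
  move=> x; apply: differentiable_continuous; apply/derivable1_diffP.
  by case: (dF x).
rewrite /Rintegral (@continuous_FTC2 _ _ F)//.
- by rewrite /F /= mulr0 expR0 /GRing.scale/= mulr1 mulrBl mul1r mulrC.
- exact: continuous_subspaceT.
- split; first by move=> x _; case: (dF x).
  + by apply: cvg_at_right_filter; exact: cF.
  + by apply: cvg_at_left_filter; exact: cF.
- by move=> x _; rewrite derive1E derive_val.
Qed.

(** The gain of a factor 1/k under integration is what turns the evolution
    operator into a contraction once the weights are steep enough. *)
Lemma le_integral_expR k a C f : measurable_fun setT f ->
  0 < k -> 0 <= a -> 0 <= C ->
  (forall x, 0 <= x <= a -> `|f x| <= C * expR (k * x)) ->
  (forall x, ~~ (0 <= x <= a) -> f x = 0) ->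
  `|\int[mu]_x f x| <= C * (expR (k * a) / k).
Proof.
move=> mf k0 a0 C0 fle f0.
have bf : bsupp a (C * expR (k * a)) f.
  apply: bsuppI => //; first by rewrite mulr_ge0// expR_ge0.
  move=> x xa; rewrite (le_trans (fle x xa))// ler_wpM2l// ler_expR ler_wpM2l ?(ltW k0)//.
  by case/andP: xa.
have -> : \int[mu]_x f x = \int[mu]_(x in `[0, a]) f x.
  rewrite [RHS]Rintegral_mkcond; apply: eq_Rintegral => x _.
  rewrite /restrict mem_setE in_itv/=.
  by case: ifPn => // /f0.
have If : mu.-integrable `[0, a] (EFin \o f).
  by apply: integrableS (bsupp_integrable mf bf).
apply: (le_trans (le_normr_Rintegral _ If)) => //.
have cE : continuous (fun x : R => expR (k * x)).
  by move=> x; apply: continuous_comp; [exact: mulrl_continuous|exact: continuous_expR].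
have Ie : mu.-integrable `[0, a] (EFin \o (fun x => expR (k * x))).
  apply: continuous_compact_integrable; first exact: segment_compact.
  exact: continuous_subspaceT.
apply: (@le_trans _ _ (\int[mu]_(x in `[0, a]) (C * expR (k * x)))).
  apply: le_Rintegral => //; first exact: (integrable_norm If).
    exact: (integrableZl _ C Ie).
rewrite RintegralZl// ler_wpM2l// integral_expR// ler_wpM2r ?invr_ge0 ?(ltW k0)//.
by rewrite lerBlDr lerDl.
Qed.

Lemma expRN_le1 (y : R) : 0 <= y -> expR (- y) <= 1.
Proof. by move=> y0; rewrite -expR0 ler_expR oppr_le0. Qed.

Lemma expRN_lipschitz (a b : R) : 0 <= a -> 0 <= b -> `|expR (- a) - expR (- b)| <= `|a - b|.
Proof.
wlog ab : a b / a <= b => [hw a0 b0|a0 b0].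
  have [/hw|/ltW/hw] := leP a b; first exact.
  by rewrite (distrC (expR _)) (distrC a); exact.
rewrite ger0_norm; last by rewrite subr_ge0 ler_expR lerN2.
rewrite distrC ger0_norm ?subr_ge0//.
have -> : expR (- b) = expR (- a) * expR (- (b - a)) by rewrite -expRD; congr expR; ring.
rewrite -[X in X - _]mulr1 -mulrBr -[leRHS]mul1r ler_pM ?expR_ge0//.
- by rewrite subr_ge0 expRN_le1// subr_ge0.
- exact: expRN_le1.
- by have := expR_ge1Dx (- (b - a)); lra.
Qed.

(** * Geometric sequences *)

Lemma geo_cvg0 (C : R) : (fun n => C / 2 ^+ n) @ \oo --> (0 : R).
Proof.
rewrite -(mulr0 C); under eq_fun do rewrite -exprVn.
by apply: cvgMr; apply: cvg_expr; rewrite ger0_norm// invf_lt1// ltr1n.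
Qed.

Lemma geo_eq0 (a C : R) : (forall n, `|a| <= C / 2 ^+ n) -> a = 0.
Proof.
move=> h; apply/eqP; rewrite -normr_eq0; apply/eqP/le_anti; rewrite normr_ge0 andbT.
by apply: (cvgr_to_ge (@geo_cvg0 C)); apply: nearW.
Qed.

(** Completeness, with the rate of convergence that makes the limit of the
    iterates uniform in all parameters. *)
Lemma cvg_geo (u : nat -> R) (C : R) : (forall n, `|u n.+1 - u n| <= C / 2 ^+ n) ->
  exists2 l : R, u n @[n --> \oo] --> l & forall n, `|u n - l| <= 2 * C / 2 ^+ n.
Proof.
move=> hu.
have C0 : 0 <= C by have := hu 0; rewrite expr0 divr1; exact: le_trans.
have pw n : 0 < (2 : R) ^+ n by rewrite exprn_gt0.
(* the factor 1 - 2^-m is what makes the induction on m go through *)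
have hd m n : `|u (n + m)%N - u n| <= 2 * C / 2 ^+ n * (1 - (2 ^+ m)^-1).
  elim: m => [|m IH]; first by rewrite addn0 subrr normr0 expr0 invr1 subrr mulr0.
  rewrite addnS -(subrKA (u (n + m)%N)) (le_trans (ler_normD _ _))//.
  apply: (le_trans (lerD (hu (n + m)%N) IH)); rewrite exprD exprS.
  have -> : C / (2 ^+ n * 2 ^+ m) + 2 * C / 2 ^+ n * (1 - (2 ^+ m)^-1) =
      2 * C / 2 ^+ n * (1 - (2 * 2 ^+ m)^-1).
    by field; rewrite !gt_eqF.
  exact: lexx.
have hb m n : `|u (n + m)%N - u n| <= 2 * C / 2 ^+ n.
  apply: (le_trans (hd m n)); rewrite ler_piMr//.
    by rewrite divr_ge0 ?mulr_ge0 ?(ltW (pw n)).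
have e0 := @geo_cvg0 (2 * C).
have /cauchy_cvg/cvg_ex[l ul] : cauchy (u @ \oo).
  apply: cauchy_exP => e e_gt0.
  have /cvgrPdist_lt/(_ e e_gt0)[n _ hn] := e0.
  exists (u n); exists n => // k /= nk.
  have := hn n (leqnn n); rewrite /ball/= sub0r normrN => hlt.
  rewrite distrC -(subnKC nk) (le_lt_trans (hb _ _))//.
  by rewrite (le_lt_trans (ler_norm _)).
exists l => // n; rewrite distrC.
have : `|u k - u n| @[k --> \oo] --> `|l - u n|.
  by apply: cvg_norm; apply: cvgB => //; exact: cvg_cst.
move=> h; apply: (cvgr_to_le h); exists n => // k /= nk.
by rewrite -(subnKC nk).
Qed.

(** * Integrals in the extended reals *)

Lemma integral_supp (D : set R) (f : R -> R) : (forall x, ~ D x -> f x = 0) ->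
  (\int[mu]_(x in D) (f x)%:E = \int[mu]_x (f x)%:E)%E.
Proof.
move=> f0; rewrite integral_mkcond; apply: eq_integral => x _.
by rewrite patchE; case: ifPn => // /negP xD; rewrite f0// => /mem_set.
Qed.

Lemma expeR_le1 (y : \bar R) : (0 <= y -> 0 <= expeR (- y) <= 1)%E.
Proof.
move=> y0; rewrite expeR_ge0/=; case: y y0 => [r| |]//=; first by rewrite !lee_fin => /expRN_le1.
Qed.

End Tools.

Section Model.
Context {R : realType} (k0 T K : R).
Notation mu := (@lebesgue_measure R).
Implicit Types (g : R -> R -> R) (t x s nu : R).

(** * The model and the class of admissible functions *)

(** The part of the domain where solutions may be nonzero. *)
Definition wedge t x := [&& 1 <= t, t <= T, 0 <= x & x <= t].

(** A majorant of all solutions; the rate 2 k0 is the one for which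
    [cap_half] holds. *)
Definition cap x := K * expR (2 * k0 * x).

(** The integrals run over the whole line because the functions considered
    vanish outside the wedge. *)
Definition population g t := \int[mu]_x g t x.
Definition pairing g t := \int[mu]_x (g t x * g t (t - x)).
Definition newborn g t := k0 / (2 * population g t) * pairing g t.
(** Since g(s, s - x) vanishes unless s >= max(1, x), the integral of the rate
    over the whole line starts at 1 when x < 1 and at x otherwise: one formula
    covers both exponents of [Gamma]. *)
Definition loss_rate g t x s := if s <= t then g s (s - x) / population g s else 0.
Definition loss g t x := k0 * \int[mu]_s loss_rate g t x s.

(** Continuity at (t, x) relative to the wedge. *)
Definition wedge_cont g t x := forall u v : nat -> R,
  (\forall n \near \oo, wedge (u n) (v n)) ->
  u n @[n --> \oo] --> t -> v n @[n --> \oo] --> x ->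
  g (u n) (v n) @[n --> \oo] --> g t x.

(** What membership in X says of a function cut to the wedge, initial values
    aside. *)
Record regular g := Regular {
  regular_out : forall t x, ~~ wedge t x -> g t x = 0;
  regular_ge0 : forall t x, 0 <= g t x;
  regular_cont : forall t x, wedge t x -> x != 1 -> x != t -> wedge_cont g t x }.

Definition capped g := forall t x, wedge t x -> g t x <= cap x.

(** Continuity on the diagonal is needed by the loss exponent at x = 0, which
    integrates g(s, s). *)
Definition diag_cont g := forall t, 1 < t <= T -> wedge_cont g t t.

Record admissible nu g := Admissible {
  admissible_regular : regular g;
  admissible_capped : capped g;
  admissible_diag : diag_cont g;
  admissible_population : forall t, 1 <= t <= T -> nu <= population g t }.

Hypotheses (k0_gt0 : 0 < k0) (T_gt1 : 1 < T) (K_gt0 : 0 < K).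

(** * Regular functions: sections, population and pairing *)

Lemma cap_ge0 x : 0 <= cap x.
Proof. by rewrite mulr_ge0 ?expR_ge0// ltW. Qed.

Lemma cap_mono x y : x <= y -> cap x <= cap y.
Proof.
move=> xy; rewrite ler_pM2l// ler_expR ler_wpM2l//.
by rewrite mulr_ge0// ltW.
Qed.

Lemma wedgeP t x : reflect ((1 <= t <= T) /\ (0 <= x <= t)) (wedge t x).
Proof. by apply: (iffP and4P) => [[-> -> -> ->]|[/andP[-> ->] /andP[-> ->]]]. Qed.

(** The strict inequalities define the open complement of the wedge, in which
    the sequence ends up. *)
Lemma regular_cvg0 g (u v : nat -> R) t x : regular g ->
  u n @[n --> \oo] --> t -> v n @[n --> \oo] --> x ->
  (t < 1) || (T < t) || (x < 0) || (t < x) ->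
  g (u n) (v n) @[n --> \oo] --> (0 : R).
Proof.
move=> pg ut vx h.
suff : \forall n \near \oo, 0 = g (u n) (v n).
  by move=> h0; apply: cvg_trans (near_eq_cvg h0) _; exact: cvg_cst.
have uvtx : v n - u n @[n --> \oo] --> x - t by exact: cvgB.
case/orP : h => [/orP[/orP[]|]|] h.
- near=> n; rewrite regular_out//; apply/wedgeP => -[/andP[+ _] _]; apply/negP.
  by rewrite -ltNge; near: n; exact: cvgr_lt ut _ h.
- near=> n; rewrite regular_out//; apply/wedgeP => -[/andP[_ +] _]; apply/negP.
  by rewrite -ltNge; near: n; exact: cvgr_gt ut _ h.
- near=> n; rewrite regular_out//; apply/wedgeP => -[_ /andP[+ _]]; apply/negP.
  by rewrite -ltNge; near: n; exact: cvgr_lt vx _ h.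
- near=> n; rewrite regular_out//; apply/wedgeP => -[_ /andP[_ +]]; apply/negP.
  rewrite -ltNge -subr_gt0; near: n; apply: cvgr_gt uvtx _ _.
  by rewrite subr_gt0.
Unshelve. all: by end_near. Qed.

(** Off the lines x = 0, x = 1 and x = t a limit point is either interior to
    the wedge or exterior to it, except at the ends of [1, T], which are
    approached from inside. *)
Lemma regular_cvg g (u v : nat -> R) t x : regular g ->
  (\forall n \near \oo, 1 <= u n <= T) -> 1 <= t <= T ->
  u n @[n --> \oo] --> t -> v n @[n --> \oo] --> x ->
  x != 0 -> x != 1 -> x != t ->
  g (u n) (v n) @[n --> \oo] --> g t x.
Proof.
move=> pg nu_ tT ut vx x0 x1 xt.
have [/wedgeP[_ /andP[x0' xt']]|D] := boolP (wedge t x); last first.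
  rewrite (regular_out pg D); apply: (regular_cvg0 pg ut vx).
  move: D; rewrite /wedge; case/andP : tT => -> -> /=; rewrite negb_and -!ltNge.
  by case/orP => ->; rewrite ?orbT.
apply: (regular_cont pg) => //; first by apply/wedgeP; rewrite x0' xt'.
have uvtx : u n - v n @[n --> \oo] --> t - x by exact: cvgB.
near=> n; apply/wedgeP; split; first by near: n.
apply/andP; split.
  by apply: ltW; near: n; apply: cvgr_gt vx _ _; rewrite lt_neqAle eq_sym x0.
rewrite -subr_ge0; apply: ltW; near: n; apply: cvgr_gt uvtx _ _.
by rewrite subr_gt0 lt_neqAle xt.
Unshelve. all: by end_near. Qed.

Lemma section_measurable g t : regular g -> measurable_fun setT (g t).
Proof.
move=> pg.
have [tT|tT] := boolP (1 <= t <= T); last first.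
  rewrite (_ : g t = cst 0); first exact: measurable_cst.
  by apply/funext => x; rewrite (regular_out pg)//; apply/wedgeP => -[]; rewrite (negbTE tT).
apply: (@measurable_off_finite _ [:: 0; 1; t]) => x.
rewrite !inE !negb_or => /and3P[x0 x1 xt].
apply: cvg_seqP => u ux.
by apply: regular_cvg => //; [exact: nearW|exact: cvg_cst].
Qed.

Lemma pair_section_measurable g h t : regular g -> regular h ->
  measurable_fun setT (fun x => g t x * h t (t - x)).
Proof.
move=> pg ph; apply: measurable_funM; first exact: section_measurable.
by apply: measurableT_comp (measurable_reflect t); exact: section_measurable.
Qed.

(** Along the line of slope 1 through (x, 0) the function is continuous except
    at the ends 1 and T, where the line enters the wedge (s = x), and where it
    crosses the line of sizes 1 (s = x + 1). For x = 0 that line is the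
    diagonal itself. *)
Lemma diag_section_measurable g x : regular g -> (x = 0 -> diag_cont g) ->
  measurable_fun setT (fun s => g s (s - x)).
Proof.
move=> pg dg; apply: (@measurable_off_finite _ [:: 1; T; x; x + 1]) => s.
rewrite !inE !negb_or => /and4P[s1 sT sx sx1].
apply: cvg_seqP => u us.
have usx : u n - x @[n --> \oo] --> s - x by apply: cvgB => //; exact: cvg_cst.
have [/wedgeP[/andP[s1' sT'] /andP[x0 xs]]|D] := boolP (wedge s (s - x)); last first.
  rewrite (regular_out pg D); apply: (regular_cvg0 pg us usx).
  move: D; rewrite /wedge !negb_and -!ltNge.
  by case/or4P => ->; rewrite ?orbT.
have us1 : \forall n \near \oo, 1 <= u n <= T.
  near=> n; apply/andP; split; apply: ltW; near: n.
    by apply: cvgr_gt us _ _; rewrite lt_neqAle eq_sym s1.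
  by apply: cvgr_lt us _ _; rewrite lt_neqAle sT.
have [x00|x00] := eqVneq x 0.
  rewrite x00 subr0 in usx *.
  apply: (dg x00) => //; first by rewrite lt_neqAle eq_sym s1 s1' sT'.
  near=> n; apply/wedgeP; split; first by near: n.
  rewrite subr0 lexx andbT; apply: le_trans ler01 _.
  by suff /andP[] : 1 <= u n <= T by []; near: n.
apply: (regular_cvg pg us1 _ us usx); first by rewrite s1'.
- by rewrite subr_eq0.
- by apply: contra sx1 => /eqP h; apply/eqP; lra.
- by apply: contra x00 => /eqP h; apply/eqP; lra.
Unshelve. all: by end_near. Qed.

Lemma capped_le g t x : regular g -> capped g -> g t x <= cap T.
Proof.
move=> pg cg; have [D|/(regular_out pg) ->] := boolP (wedge t x); last exact: cap_ge0.
apply: le_trans (cg _ _ D) _; apply: cap_mono.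
by have /wedgeP[/andP[_ tT] /andP[_ xt]] := D; exact: le_trans tT.
Qed.

Lemma section_bsupp g t : regular g -> capped g -> bsupp T (cap T) (g t).
Proof.
move=> pg cg; apply: bsuppI; first exact: cap_ge0.
  by move=> x _; rewrite ger0_norm; [exact: capped_le|exact: regular_ge0].
move=> x xT; apply: (regular_out pg); apply: contra xT => /wedgeP[/andP[_ tT] /andP[-> /=]].
by move/le_trans; exact.
Qed.

Lemma pair_section_bsupp g h t : regular g -> capped g -> regular h -> capped h ->
  bsupp T (cap T * cap T) (fun x => g t x * h t (t - x)).
Proof.
move=> pg cg ph ch x; rewrite normrM mulrAC ler_pM//; first exact: section_bsupp.
by rewrite ger0_norm; [exact: capped_le|exact: regular_ge0].
Qed.

Lemma pair_section_integrable g h t : regular g -> capped g -> regular h -> capped h ->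
  mu.-integrable setT (EFin \o (fun x => g t x * h t (t - x))).
Proof.
move=> pg cg ph ch; apply: (bsupp_integrable (pair_section_measurable t pg ph)).
exact: pair_section_bsupp.
Qed.

Lemma pair_section_sym g h t : regular g -> capped g -> regular h -> capped h ->
  \int[mu]_x (g t x * h t (t - x)) = \int[mu]_x (h t x * g t (t - x)).
Proof.
move=> pg cg ph ch.
have e : (fun x => g t x * h t (t - x)) =
    (fun x => (fun y => h t y * g t (t - y)) (t - x)).
  by apply/funext => x /=; rewrite mulrC; congr (_ * g t _); ring.
rewrite [in LHS]e; apply: (@Rintegral_reflect _ T (cap T * cap T) (fun y => h t y * g t (t - y))).
- exact: pair_section_measurable.
- exact: pair_section_bsupp.
- by rewrite -e; exact: pair_section_bsupp.
Qed.

Lemma section_integrable g t : regular g -> capped g -> mu.-integrable setT (EFin \o g t).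
Proof. by move=> pg cg; apply: (bsupp_integrable (section_measurable t pg)); exact: section_bsupp. Qed.

Lemma population_ge0 g t : regular g -> 0 <= population g t.
Proof. by move=> pg; apply: Rintegral_ge0 => x _; exact: regular_ge0. Qed.

Lemma pairing_ge0 g t : regular g -> 0 <= pairing g t.
Proof. by move=> pg; apply: Rintegral_ge0 => x _; rewrite mulr_ge0//; exact: regular_ge0. Qed.

Lemma newborn_ge0 g t : regular g -> 0 <= newborn g t.
Proof. by move=> pg; rewrite mulr_ge0 ?pairing_ge0// divr_ge0 ?mulr_ge0 ?population_ge0// ltW. Qed.

Lemma population_out g t : regular g -> ~~ (1 <= t <= T) -> population g t = 0.
Proof.
move=> pg tT; rewrite /population (_ : g t = cst 0) ?Rintegral_cst ?mul0r//.
by apply/funext => x; rewrite (regular_out pg)//; apply/wedgeP => -[]; rewrite (negbTE tT).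
Qed.

Lemma population_cvg g (u : nat -> R) t : regular g -> capped g ->
  (\forall n \near \oo, 1 <= u n <= T) -> 1 <= t <= T -> u n @[n --> \oo] --> t ->
  population g (u n) @[n --> \oo] --> population g t.
Proof.
move=> pg cg nu_ tT ut; apply: (@dominated_cvg_off _ [:: 0; 1; t] T (cap T)).
- by move=> n; exact: section_measurable.
- exact: section_measurable.
- by move=> n; exact: section_bsupp.
move=> x; rewrite !inE !negb_or => /and3P[x0 x1 xt].
by apply: (@regular_cvg g u (fun=> x)) => //; exact: cvg_cst.
Qed.

Lemma pairing_cvg g (u : nat -> R) t : regular g -> capped g ->
  (\forall n \near \oo, 1 <= u n <= T) -> 1 <= t <= T -> u n @[n --> \oo] --> t ->
  pairing g (u n) @[n --> \oo] --> pairing g t.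
Proof.
move=> pg cg nu_ tT ut.
apply: (@dominated_cvg_off _ [:: 0; 1; t; t - 1] T (cap T * cap T)).
- by move=> n; exact: pair_section_measurable.
- exact: pair_section_measurable.
- by move=> n; exact: pair_section_bsupp.
move=> x; rewrite !inE !negb_or => /and4P[x0 x1 xt xt1].
apply: cvgM; first by apply: (@regular_cvg g u (fun=> x)) => //; exact: cvg_cst.
apply: (@regular_cvg g u (fun n => u n - x)) => //.
- by apply: cvgB => //; exact: cvg_cst.
- by rewrite subr_eq0 eq_sym.
- by apply: contra xt1 => /eqP h; apply/eqP; lra.
- by apply: contra x0 => /eqP h; apply/eqP; lra.
Qed.

Lemma newborn_cvg g (u : nat -> R) t : regular g -> capped g -> 0 < population g t ->
  (\forall n \near \oo, 1 <= u n <= T) -> 1 <= t <= T -> u n @[n --> \oo] --> t ->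
  newborn g (u n) @[n --> \oo] --> newborn g t.
Proof.
move=> pg cg N0 nu_ tT ut; apply: cvgM; last exact: pairing_cvg.
apply: cvgM; first exact: cvg_cst.
apply: cvgV; first by rewrite gt_eqF// mulr_gt0.
by apply: cvgM; [exact: cvg_cst|exact: population_cvg].
Qed.

Lemma population_measurable g : regular g -> capped g -> measurable_fun setT (population g).
Proof.
move=> pg cg; apply: (@measurable_off_finite _ [:: 1; T]) => t.
rewrite !inE !negb_or => /andP[t1 tT]; apply: cvg_seqP => u ut.
have [/andP[t1' tT']|] := boolP (1 <= t <= T).
  apply: population_cvg => //; last by rewrite t1'.
  near=> n; apply/andP; split; apply: ltW; near: n.
    by apply: cvgr_gt ut _ _; rewrite lt_neqAle eq_sym t1.
  by apply: cvgr_lt ut _ _; rewrite lt_neqAle tT.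
move=> D; rewrite (population_out pg D).
suff : \forall n \near \oo, 0 = population g (u n).
  by move=> h0; apply: cvg_trans (near_eq_cvg h0) _; exact: cvg_cst.
move: D; rewrite negb_and -!ltNge => /orP[] h; near=> n; rewrite population_out// negb_and -!ltNge.
  by apply/orP; left; near: n; exact: cvgr_lt ut _ h.
by apply/orP; right; near: n; exact: cvgr_gt ut _ h.
Unshelve. all: by end_near. Qed.

Lemma population_reflect g t : regular g -> capped g -> \int[mu]_x g t (t - x) = population g t.
Proof.
move=> pg cg; apply: (@Rintegral_reflect _ T (cap T)) => //.
- exact: section_measurable.
- exact: section_bsupp.
apply: bsuppI; first exact: cap_ge0.
  by move=> x _; rewrite ger0_norm; [exact: capped_le|exact: regular_ge0].
move=> x xT; apply: (regular_out pg); apply: contra xT => /wedgeP[/andP[_ tT] /andP[]].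
rewrite subr_ge0 gerBl => xt -> /=; exact: le_trans xt tT.
Qed.

(** The square of e^{k0 t} on the right beats the factor k0 on the left, as
    k0 <= e^{k0 t} for t >= 1. *)
Lemma cap_half t : 1 <= t -> k0 * cap (t / 2) <= cap t.
Proof.
move=> t1; rewrite /cap mulrCA ler_pM2l//.
have -> : 2 * k0 * (t / 2) = k0 * t by field.
rewrite (_ : 2 * k0 * t = k0 * t + k0 * t); last by ring.
rewrite expRD ler_wpM2r ?expR_ge0//.
have := expR_ge1Dx (k0 * t).
have : k0 <= k0 * t by rewrite ler_peMr// ltW.
lra.
Qed.

(** One of the two partners has size at most t/2, so the product of their
    densities is at most cap(t/2) times the sum of the densities; that sum
    integrates to 2 N(t), which cancels the denominator. *)
Lemma newborn_cap g t : regular g -> capped g -> 0 < population g t -> 1 <= t -> newborn g t <= cap t.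
Proof.
move=> pg cg N0 t1.
have mx := section_measurable t pg.
have mr : measurable_fun setT (fun x => g t (t - x)).
  exact: measurableT_comp (measurable_reflect t).
have Ir : mu.-integrable setT (EFin \o (fun x => g t (t - x))).
  apply: (@bsupp_integrable _ T (cap T)) => //; apply: bsuppI; first exact: cap_ge0.
    by move=> x _; rewrite ger0_norm; [exact: capped_le|exact: regular_ge0].
  move=> x xT; apply: (regular_out pg); apply: contra xT => /wedgeP[/andP[_ tT] /andP[]].
  by rewrite subr_ge0 gerBl => xt -> /=; exact: le_trans xt tT.
have Ix := section_integrable t pg cg.
have Q : pairing g t <= cap (t / 2) * (2 * population g t).
  have -> : 2 * population g t = \int[mu]_x (g t x + g t (t - x)).
    by rewrite RintegralD// population_reflect//; rewrite /population; lra.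
  rewrite -RintegralZl//; last exact: (integrableD _ Ix Ir).
  apply: le_Rintegral => //.
  - exact: pair_section_integrable.
  - by apply: (integrableZl _ _ (integrableD _ Ix Ir)).
  move=> x _.
  have gx0 := regular_ge0 pg t x; have gy0 := regular_ge0 pg t (t - x).
  have [D|/(regular_out pg) g0] := boolP (wedge t x); last first.
    by rewrite g0 mul0r mulr_ge0 ?cap_ge0// addr_ge0.
  have [D'|/(regular_out pg) g0] := boolP (wedge t (t - x)); last first.
    by rewrite g0 mulr0 mulr_ge0 ?cap_ge0// addr_ge0.
  have [xt|xt] := leP x (t / 2).
    have := le_trans (cg _ _ D) (cap_mono xt); nra.
  have := le_trans (cg _ _ D') (cap_mono (_ : t - x <= t / 2)); nra.
apply: le_trans (cap_half t1); rewrite /newborn mulrAC ler_pdivrMr ?mulr_gt0//.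
by rewrite -mulrA ler_pM2l.
Qed.

(** * The loss exponent *)

Lemma loss_rate_measurable g t x : regular g -> capped g -> (x = 0 -> diag_cont g) ->
  measurable_fun setT (loss_rate g t x).
Proof.
move=> pg cg dg; apply: measurable_fun_ifT.
- by apply: measurable_fun_ler => //; exact: measurable_cst.
- apply: measurable_funM; first exact: diag_section_measurable.
  by apply: measurable_funV; exact: population_measurable.
- exact: measurable_cst.
Qed.

Lemma loss_rate_ge0 g t x s : regular g -> 0 <= loss_rate g t x s.
Proof.
move=> pg; rewrite /loss_rate; case: ifP => // _.
by rewrite divr_ge0 ?population_ge0//; exact: regular_ge0.
Qed.

Lemma loss_rate_out g t x s : regular g -> ~~ [&& 1 <= s, s <= T, x <= s & s <= t] ->
  loss_rate g t x s = 0.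
Proof.
move=> pg; rewrite /loss_rate; case: ifP => [st|//]; rewrite ?andbF// andbT => h.
rewrite (regular_out pg) ?mul0r//; apply: contra h => /wedgeP[/andP[-> ->]].
by rewrite subr_ge0 => /andP[->].
Qed.

Lemma loss_rate_le nu g t x s : regular g -> capped g -> 0 < nu ->
  (forall t, 1 <= t <= T -> nu <= population g t) -> loss_rate g t x s <= cap T / nu.
Proof.
move=> pg cg nu0 gN.
have C0 : 0 <= cap T / nu by rewrite divr_ge0 ?cap_ge0// ltW.
have [h|/(loss_rate_out pg) -> //] := boolP [&& 1 <= s, s <= T, x <= s & s <= t].
have /and4P[s1 sT _ st] := h.
have Ns := gN s; rewrite s1 sT in Ns; have {}Ns := Ns isT.
have N0 : 0 < population g s by exact: lt_le_trans Ns.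
rewrite /loss_rate st ler_pM ?invr_ge0 ?population_ge0//; [exact: regular_ge0|exact: capped_le|].
by rewrite lef_pV2// posrE.
Qed.

Lemma loss_rate_bsupp nu g t x : regular g -> capped g -> 0 < nu ->
  (forall t, 1 <= t <= T -> nu <= population g t) -> bsupp T (cap T / nu) (loss_rate g t x).
Proof.
move=> pg cg nu0 gN; apply: bsuppI => [|s _|s sT].
- by rewrite divr_ge0 ?cap_ge0// ltW.
- by rewrite ger0_norm ?loss_rate_ge0//; exact: loss_rate_le.
apply: (loss_rate_out pg); apply: contra sT => /and4P[s1 -> _ _].
by rewrite andbT (le_trans ler01).
Qed.

Lemma loss_rate_integrable nu g t x : regular g -> capped g -> 0 < nu ->
  (forall t, 1 <= t <= T -> nu <= population g t) -> (x = 0 -> diag_cont g) ->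
  mu.-integrable setT (EFin \o loss_rate g t x).
Proof.
move=> pg cg nu0 gN dg; apply: (@bsupp_integrable _ T (cap T / nu)).
  exact: loss_rate_measurable.
exact: loss_rate_bsupp.
Qed.

Lemma loss_ge0 g t x : regular g -> 0 <= loss g t x.
Proof.
by move=> pg; rewrite mulr_ge0 ?(ltW k0_gt0)//; apply: Rintegral_ge0 => s _; exact: loss_rate_ge0.
Qed.

(** The rate lives on s >= a, whether a is the time 1 or the birth time x: the
    exponent is small when t is close to a. *)
Lemma loss_le nu g a t x : regular g -> capped g -> 0 < nu ->
  (forall t, 1 <= t <= T -> nu <= population g t) -> (x = 0 -> diag_cont g) ->
  (a <= x) || (a <= 1) -> a <= t -> loss g t x <= k0 * (cap T / nu * (t - a)).
Proof.
move=> pg cg nu0 gN dg ax at_; rewrite /loss ler_pM2l//.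
have C0 : 0 <= cap T / nu by rewrite divr_ge0 ?cap_ge0// ltW.
have -> : cap T / nu * (t - a) = \int[mu]_s (cap T / nu * \1_(`[a, t]) s).
  have h := @integrable_indic_itv R a t true false.
  rewrite RintegralZl// /Rintegral integral_indic// setIT.
  have := @lebesgue_measure_itv R `[a, t] => /= ->.
  by rewrite lte_fin; case: ltgtP at_ => // -> _; rewrite subrr.
apply: le_Rintegral => //.
- exact: (loss_rate_integrable _ pg cg nu0).
- exact: (integrableZl _ _ (integrable_indic_itv a t true false)).
move=> s _; rewrite indicE mem_setE in_itv/=.
have [_|h] := boolP (a <= s <= t); first by rewrite mulr1; exact: loss_rate_le.
rewrite mulr0 (loss_rate_out pg)//; apply: contra h => /and4P[s1 _ xs ->].
by rewrite andbT; case/orP : ax => /le_trans; exact.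
Qed.

(** The rate at a fixed time s depends continuously on (t, x) off the five
    times listed in the proof, so dominated convergence applies. *)
Lemma loss_cvg nu g (u v : nat -> R) t x : admissible nu g -> 0 < nu ->
  (\forall n \near \oo, wedge (u n) (v n)) -> wedge t x ->
  u n @[n --> \oo] --> t -> v n @[n --> \oo] --> x ->
  loss g (u n) (v n) @[n --> \oo] --> loss g t x.
Proof.
move=> [pg cg dg gN] nu0 uvD Dtx ut vx; apply: cvgM; first exact: cvg_cst.
apply: (@dominated_cvg_off _ [:: t; x; x + 1; 1; T] T (cap T / nu)).
- by move=> n; exact: loss_rate_measurable.
- exact: loss_rate_measurable.
- by move=> n; exact: loss_rate_bsupp.
move=> s; rewrite !inE !negb_or => /and5P[st sx sx1 s1 sT].
have [ts|ts|ts] := ltgtP t s; last by rewrite ts eqxx in st.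
  rewrite [loss_rate g t x s]/loss_rate leNgt ts /=.
  suff : \forall n \near \oo, 0 = loss_rate g (u n) (v n) s.
    by move=> h0; apply: cvg_trans (near_eq_cvg h0) _; exact: cvg_cst.
  by near=> n; rewrite /loss_rate leNgt ifF//; apply/negbF; near: n; exact: cvgr_lt ut _ ts.
have h1 : \forall n \near \oo, g s (s - v n) / population g s = loss_rate g (u n) (v n) s.
  by near=> n; rewrite /loss_rate ifT//; apply: ltW; near: n; exact: cvgr_gt ut _ ts.
apply: cvg_trans (near_eq_cvg h1) _.
rewrite /loss_rate (ltW ts); apply: cvgM; last exact: cvg_cst.
have svx : s - v n @[n --> \oo] --> s - x by apply: cvgB => //; exact: cvg_cst.
have [s1T|] := boolP (1 <= s <= T); last first.
  move=> h; rewrite (regular_out pg) => [|]; last first.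
    by apply/wedgeP => -[]; rewrite (negbTE h).
  apply: (regular_cvg0 pg (cvg_cst s) svx).
  by move: h; rewrite negb_and -!ltNge => /orP[] ->; rewrite ?orbT.
(* for x = 0 the points (s, s - v n) approach the diagonal from below *)
have [x0|x0] := eqVneq x 0; last first.
  apply: (regular_cvg pg _ s1T (cvg_cst s) svx); first exact: nearW.
  - by rewrite subr_eq0.
  - by apply: contra sx1 => /eqP h; apply/eqP; lra.
  - by apply: contra x0 => /eqP h; apply/eqP; lra.
have s1' : 1 < s by rewrite lt_neqAle eq_sym s1; case/andP : s1T.
rewrite x0 subr0 in svx *; apply: dg => //.
- by rewrite s1'; case/andP : s1T.
- near=> n; apply/wedgeP; split => //; rewrite subr_ge0 gerBl; apply/andP; split.
    apply: ltW; near: n; apply: cvgr_lt vx _ _; rewrite x0; exact: lt_trans s1'.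
  by suff /wedgeP[_ /andP[]] : wedge (u n) (v n) by []; near: n.
- exact: cvg_cst.
Unshelve. all: by end_near. Qed.

(** * The total loss of the initial population *)

Lemma wedge_closed : closed [set p : R * R | wedge p.1 p.2].
Proof.
have -> : [set p : R * R | wedge p.1 p.2] =
  [set p : R * R | 1 <= p.1] `&` [set p : R * R | p.1 <= T] `&`
  [set p : R * R | 0 <= p.2] `&` [set p : R * R | p.2 - p.1 <= 0].
  apply/seteqP; split=> -[t x] /=; rewrite subr_le0; first by case/and4P.
  by move=> [[[h1 h2] h3] h4]; apply/and4P.
have c1 : continuous (fst : R * R -> R) by move=> ?; exact: cvg_fst.
have c2 : continuous (snd : R * R -> R) by move=> ?; exact: cvg_snd.
repeat apply: closedI.
- apply: (@closed_comp _ _ (fst : R * R -> R) [set y | 1 <= y]); [by move=> p _; exact: c1|exact: closed_ge].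
- apply: (@closed_comp _ _ (fst : R * R -> R) [set y | y <= T]); [by move=> p _; exact: c1|exact: closed_le].
- apply: (@closed_comp _ _ (snd : R * R -> R) [set y | 0 <= y]); [by move=> p _; exact: c2|exact: closed_ge].
- apply: (@closed_comp _ _ (fun p : R * R => p.2 - p.1) [set y | y <= 0]); last exact: closed_le.
  by move=> p _; apply: cvgB; [exact: c2|exact: c1].
Qed.

(** Removing the line of sizes 1, where no continuity is known, leaves a function
    continuous relative to its domain, hence jointly measurable; each line of
    slope 1 meets the removed set in one point. *)
Definition off_line g : R * R -> R :=
  (fun p : R * R => g p.1 p.2) \_ [set p | wedge p.1 p.2 && (p.2 != 1)].

Lemma off_line_measurable nu g : admissible nu g -> measurable_fun setT (off_line g).
Proof.
move=> [pg cg dg gN].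
have mD : measurable [set p : R * R | wedge p.1 p.2 && (p.2 != 1)].
  have -> : [set p : R * R | wedge p.1 p.2 && (p.2 != 1)] =
    [set p : R * R | wedge p.1 p.2] `&` [set p : R * R | p.2 != 1].
    by apply/seteqP; split=> p /= => [/andP[]//|[-> ->]].
  apply: measurableI; first by apply: (@closed_measurable_prod R); exact: wedge_closed.
  apply: (@open_measurable_prod R).
  apply: (@open_comp _ _ (snd : R * R -> R) [set y | y != 1]); last exact: open_neq.
  by move=> p _; exact: cvg_snd.
apply/(measurable_restrictT _ mD); apply: (@measurable_fun_within R) => // -[t x] /= /andP[D x1].
apply: (@cvg_seq_within R) => u v uvD ut vx /=.
have nD : \forall n \near \oo, wedge (u n) (v n).
  by apply: nearW => n; have /= /andP[] := uvD n.
have [xt|xt] := eqVneq x t; last exact: (regular_cont pg).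
subst x; apply: dg => //.
have /and4P[t1 tT _ _] := D.
by rewrite tT andbT lt_neqAle eq_sym x1.
Qed.

Lemma off_line_eq g s x : regular g -> x != 1 -> off_line g (s, x) = g s x.
Proof.
move=> pg x1; rewrite /off_line/= patchE; case: ifPn => //; rewrite notin_setE/=.
by rewrite x1 andbT => /negP/(regular_out pg).
Qed.

Lemma off_line_ge0 g p : regular g -> 0 <= off_line g p.
Proof. by move=> pg; rewrite /off_line/= patchE; case: ifP => // _; exact: regular_ge0. Qed.

Lemma off_line_le g s x : regular g -> off_line g (s, x) <= g s x.
Proof. by move=> pg; rewrite /off_line/= patchE; case: ifP => // _; exact: regular_ge0. Qed.

(** By Tonelli the integral in x comes first, and the integral of g(s, s - x)
    over x is at most N(s). The bound thus depends neither on g nor on a lower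
    bound of its population. *)
Lemma loss_rate_mass nu g t : admissible nu g -> 0 < nu -> 1 <= t <= T ->
  let H x := \1_(`[0, 1[) x * \int[mu]_s loss_rate g t x s in
  measurable_fun setT H /\ (\int[mu]_x (H x)%:E <= (t - 1)%:E)%E.
Proof.
move=> ag nu0 tT H; have [pg cg dg gN] := ag.
pose F (p : R * R) := \1_(`[0, 1[) p.1 * \1_(`[1, t]) p.2 * (off_line g (p.2, p.2 - p.1) / population g p.2).
have F0 p : 0 <= F p.
  apply: mulr_ge0; first by rewrite mulr_ge0.
  by rewrite divr_ge0 ?population_ge0 ?off_line_ge0.
have mF : measurable_fun setT F.
  apply: measurable_funM; first apply: measurable_funM.
  - by apply: measurableT_comp => //; exact: measurable_indic.
  - by apply: measurableT_comp => //; exact: measurable_indic.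
  apply: measurable_funM.
    apply: (measurableT_comp (off_line_measurable ag)).
    apply: measurable_fun_pair => //.
    exact: measurable_funB.
  apply: measurable_funV.
  by apply: (measurableT_comp (population_measurable pg cg)).
have mEF : measurable_fun setT (EFin \o F) by exact/measurable_EFinP.
have FE x : (\int[mu]_s (F (x, s))%:E = (H x)%:E)%E.
  rewrite /H indicE mem_setE in_itv/=.
  have [x01|x01] := boolP (0 <= x < 1); last first.
    rewrite mul0r; apply: integral0_eq => s _.
    by rewrite /F/= indicE mem_setE in_itv/= (negbTE x01) !mul0r.
  rewrite mul1r /Rintegral fineK; last first.
    apply: integrable_fin_num => //.
    exact: (loss_rate_integrable _ pg cg nu0 gN).
  apply: ae_eq_integral => //.
  - exact: (measurableT_comp mEF (pair1_measurable x)).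
  - apply/measurable_EFinP; exact: loss_rate_measurable.
  (* the only time at which the removed line is met *)
  exists [set x + 1]; split; [exact: measurable_set1|exact: lebesgue_measure_set1|].
  move=> s /= hs; apply: contrapT => sx; apply: hs => _; congr EFin.
  rewrite /F /loss_rate/= !indicE !mem_setE !in_itv/= x01 mul1r.
  have sx1 : s - x != 1 by apply/eqP => h; apply: sx; lra.
  have [st|st] := leP s t; last by rewrite andbF mul0r.
  rewrite andbT off_line_eq//.
  have [s1|s1] := leP 1 s; first by rewrite mul1r.
  rewrite mul0r (regular_out pg) ?mul0r//.
  by rewrite /wedge leNgt s1.
split.
  apply/measurable_EFinP.
  have := measurable_fun_fubini_tonelli_F (m2 := mu) _ mEF (fun p => _ (F0 p)).
  rewrite /fubini_F; under eq_fun do rewrite FE.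
  by apply.
under eq_integral do rewrite -FE.
rewrite (fubini_tonelli (m1 := mu) (m2 := mu) (EFin \o F))//.
have le1 s : (\int[mu]_x (F (x, s))%:E <= (\1_(`[1, t]) s)%:E)%E.
  have [s1|s1] := boolP (1 <= s <= t); last first.
    have ind0 : \1_(`[1, t]) s = 0 :> R by rewrite indicE mem_setE in_itv/= (negbTE s1).
    by rewrite ind0 integral0_eq// => x _; rewrite /F/= ind0 mulr0 mul0r.
  have sT : 1 <= s <= T.
    by case/andP : s1 => -> /le_trans; apply; case/andP : tT.
  have N0 : 0 < population g s by apply: lt_le_trans (gN s sT).
  apply: (@le_trans _ _ (\int[mu]_x ((population g s)^-1 * g s (s - x))%:E)%E).
    apply: ge0_le_integral => //.
    - by move=> x _; rewrite lee_fin.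
    - exact: (measurableT_comp mEF (pair2_measurable s)).
    - apply/measurable_EFinP; apply: measurable_funM => //.
      by apply: measurableT_comp (measurable_reflect s); exact: section_measurable.
    - move=> x _; rewrite lee_fin [leRHS]mulrC /F/=.
      apply: (@le_trans _ _ (off_line g (s, s - x) / population g s)).
        apply: ler_piMl; first by rewrite divr_ge0 ?population_ge0 ?off_line_ge0.
        by rewrite !indicE; do 2 case: (_ \in _); rewrite ?mulr0 ?mul0r ?mulr1.
      by rewrite ler_wpM2r ?invr_ge0 ?population_ge0 ?off_line_le.
  under eq_integral do rewrite EFinM.
  rewrite ge0_integralZl//; last 3 first.
  - apply/measurable_EFinP.
    by apply: measurableT_comp (measurable_reflect s); exact: section_measurable.
  - by move=> x _; rewrite lee_fin; exact: regular_ge0.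
  - by rewrite lee_fin invr_ge0 population_ge0.
  rewrite (ge0_integral_reflect s (h := EFin \o g s)); last 2 first.
  - by apply/measurable_EFinP; exact: section_measurable.
  - by move=> x; rewrite lee_fin; exact: regular_ge0.
  rewrite -[X in (_ * X)%E]fineK; last exact: integrable_fin_num (section_integrable s pg cg).
  rewrite -EFinM lee_fin mulVf; last by rewrite gt_eqF.
  by rewrite indicE mem_setE in_itv/= s1.
apply: (@le_trans _ _ (\int[mu]_s (\1_(`[1, t]) s)%:E)%E).
  apply: ge0_le_integral => //.
  - by move=> s _; apply: integral_ge0 => x _; rewrite lee_fin.
  - exact: (measurable_fun_fubini_tonelli_G (m1 := mu) _ mEF).
  - by apply/measurable_EFinP; exact: measurable_indic.
  - by move=> s _; exact: le1.
rewrite integral_indic// setIT; have := @lebesgue_measure_itv R `[1, t] => /= ->.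
by rewrite lte_fin; case: ifP => // _; rewrite lee_fin subr_ge0; case/andP : tT.
Qed.

(** * The evolution operator preserves admissibility *)

Variables (gini : R -> R) (delta : R).
Hypotheses (delta_gt0 : 0 < delta)
  (gini_cont : {within `[0, 1], continuous gini})
  (gini_ge : forall x, 0 <= x <= 1 -> delta <= gini x)
  (gini_le : forall x, 0 <= x <= 1 -> gini x <= K).

Definition source g x := if x < 1 then gini x else newborn g x.

(** The real-valued form of [Gamma], cut to the wedge. *)
Definition evolve g t x := if wedge t x then source g x * expR (- loss g t x) else 0.

(** The initial density is at least [delta], and the average loss exponent over
    the sizes below 1 is at most k0 (T - 1). *)
Definition pop_floor := delta * expR (- (k0 * (T - 1))).

Lemma gini_cvg (v : nat -> R) x : (\forall n \near \oo, 0 <= v n <= 1) ->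
  0 <= x <= 1 -> v n @[n --> \oo] --> x -> gini (v n) @[n --> \oo] --> gini x.
Proof.
move=> v01 x01 vx.
have /subspace_continuousP/(_ x) := gini_cont.
rewrite /= in_itv/= => /(_ x01) h; apply: cvg_comp h => A.
rewrite /within/= => wA; have := vx _ wA.
by apply: filterS2 v01 => n vn; apply; rewrite /= in_itv.
Qed.

Lemma source_ge0 g x : regular g -> 0 <= x -> 0 <= source g x.
Proof.
move=> pg x0; rewrite /source; case: ifPn => [x1|_]; last exact: newborn_ge0.
by apply: ltW; apply: lt_le_trans delta_gt0 _; apply: gini_ge; rewrite x0 ltW.
Qed.

Lemma source_cap nu g x : admissible nu g -> 0 < nu -> 0 <= x <= T -> source g x <= cap x.
Proof.
move=> [pg cg dg gN] nu0 /andP[x0 xT]; rewrite /source; case: ltP => x1.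
  rewrite (le_trans (gini_le _)) ?x0 ?(ltW x1)// -[leLHS]mulr1 ler_pM2l//.
  by rewrite -expR0 ler_expR !mulr_ge0 ?(ltW k0_gt0).
by apply: newborn_cap => //; apply: lt_le_trans nu0 (gN _ _); rewrite x1.
Qed.

(** Continuity holds on the diagonal as well, since the birth term depends on x
    alone and the loss exponent is continuous up to the diagonal. *)
Lemma evolve_cont nu g t x : admissible nu g -> 0 < nu -> wedge t x -> x != 1 ->
  wedge_cont (evolve g) t x.
Proof.
move=> ag nu0 D x1 u v uvD ut vx; have [pg cg dg gN] := ag.
have /wedgeP[/andP[t1 tT] /andP[x0 xt]] := D.
rewrite [evolve g t x]/evolve D.
suff : source g (v n) * expR (- loss g (u n) (v n)) @[n --> \oo] -->
       source g x * expR (- loss g t x).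
  apply: cvg_trans; apply: near_eq_cvg; near=> n; rewrite /evolve ifT//.
  by near: n.
apply: cvgM; last first.
  apply: continuous_cvg; first exact: continuous_expR.
  by apply: cvgN; exact: (loss_cvg ag).
rewrite [source g x]/source; case: ifPn => [x1'|x1'].
  have : gini (v n) @[n --> \oo] --> gini x.
    apply: gini_cvg => //; last by rewrite x0 ltW.
    near=> n; apply/andP; split.
      by suff /wedgeP[_ /andP[]] : wedge (u n) (v n) by []; near: n.
    by apply: ltW; near: n; exact: cvgr_lt vx _ x1'.
  apply: cvg_trans; apply: near_eq_cvg; near=> n; rewrite /source ifT//.
  by near: n; exact: cvgr_lt vx _ x1'.
have {}x1 : 1 < x by rewrite lt_neqAle eq_sym x1 leNgt.
have : newborn g (v n) @[n --> \oo] --> newborn g x.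
  apply: newborn_cvg => //.
  - by apply: lt_le_trans nu0 (gN _ _); rewrite (ltW x1) (le_trans xt).
  - near=> n; apply/andP; split; first by apply: ltW; near: n; exact: cvgr_gt vx _ x1.
    suff /wedgeP[/andP[_ uT] /andP[_ vu]] : wedge (u n) (v n) by exact: le_trans uT.
    by near: n.
  - by rewrite (ltW x1) (le_trans xt).
apply: cvg_trans; apply: near_eq_cvg; near=> n; rewrite /source ifF//.
by apply/negbTE; rewrite -leNgt ltW//; near: n; exact: cvgr_gt vx _ x1.
Unshelve. all: by end_near. Qed.

Lemma evolve_regular nu g : admissible nu g -> 0 < nu -> regular (evolve g).
Proof.
move=> ag nu0; have [pg cg dg gN] := ag; split => [t x D|t x|t x D x1 _].
- by rewrite /evolve (negbTE D).
- rewrite /evolve; case: ifP => // /and4P[_ _ x0 _].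
  by rewrite mulr_ge0 ?expR_ge0// source_ge0.
- exact: (evolve_cont ag).
Qed.

Lemma evolve_capped nu g : admissible nu g -> 0 < nu -> capped (evolve g).
Proof.
move=> ag nu0 t x D; have [pg cg dg gN] := ag; rewrite /evolve D.
have /wedgeP[/andP[t1 tT] /andP[x0 xt]] := D.
rewrite -[leRHS]mulr1 ler_pM ?expR_ge0 ?source_ge0//.
  by apply: (source_cap ag) => //; rewrite x0 (le_trans xt).
by apply: expRN_le1; exact: loss_ge0.
Qed.

(** Jensen's inequality for exp, in the form of its tangent at -c with
    c = k0 (T - 1): e^{-E} >= e^{-c} (1 + c - E). The integral of E over [0,1[
    is at most c by [loss_rate_mass], so that of the bracket is at least 1. *)
Lemma evolve_population_ge nu g t : admissible nu g -> 0 < nu -> 1 <= t <= T -> pop_floor <= population (evolve g) t.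
Proof.
move=> ag nu0 tT; have [pg cg dg gN] := ag.
have [mH H1] := loss_rate_mass ag nu0 tT.
set H := (X in measurable_fun _ X) in mH.
pose c := k0 * (T - 1).
have t1 : 1 <= t by case/andP : tT.
have bH : bsupp 1 (cap T / nu * t) H.
  apply: bsuppI.
  - by apply: mulr_ge0; [rewrite divr_ge0 ?cap_ge0// ltW|exact: le_trans t1].
  - move=> x /andP[x0 x1].
    have h0 : 0 <= \int[mu]_s loss_rate g t x s by apply: Rintegral_ge0 => s _; exact: loss_rate_ge0.
    have h1 : \int[mu]_s loss_rate g t x s <= cap T / nu * t.
      have := @loss_le nu g 0 t x pg cg nu0 gN (fun _ => dg).
      by rewrite x0 subr0 /loss ler_pM2l//; apply => //; exact: le_trans t1.
    rewrite /H indicE; case: (_ \in _); rewrite ?mul1r ?mul0r ger0_norm//.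
    exact: le_trans h1.
  - move=> x x01; rewrite /H indicE mem_setE in_itv/=.
    have [/andP[x0 x1]|_] := boolP (0 <= x < 1); last by rewrite mul0r.
    by move: x01; rewrite x0 ltW.
have IH := bsupp_integrable mH bH.
have H2 : \int[mu]_x H x <= t - 1.
  by rewrite -lee_fin /Rintegral fineK//; exact: integrable_fin_num IH.
have I1 := @integrable_indic_itv R 0 1 true true.
have E1 : \int[mu]_x \1_(`[0, 1[) x = 1 :> R.
  rewrite /Rintegral integral_indic// setIT; have := @lebesgue_measure_itv R `[0, 1[ => /= ->.
  by rewrite lte_fin ltr01/= subr0.
(* the tangent-line minorant of the evolved density *)
pose J x := delta * expR (- c) * ((1 + c) * \1_(`[0, 1[) x - k0 * H x).
have Ia : mu.-integrable setT (EFin \o (fun x => (1 + c) * \1_(`[0, 1[) x)).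
  exact: (integrableZl _ _ I1).
have Ib : mu.-integrable setT (EFin \o (fun x => k0 * H x)).
  exact: (integrableZl _ _ IH).
have Iab : mu.-integrable setT (EFin \o (fun x => (1 + c) * \1_(`[0, 1[) x - k0 * H x)).
  exact: (integrableB _ Ia Ib).
have IJ : mu.-integrable setT (EFin \o J) by exact: (integrableZl _ _ Iab).
apply: (@le_trans _ _ (\int[mu]_x J x)).
  rewrite /J RintegralZl// RintegralB// !RintegralZl// E1 mulr1 /pop_floor -/c.
  rewrite -[leLHS]mulr1 ler_pM2l ?mulr_gt0 ?expR_gt0//.
  have tT' : t <= T by case/andP : tT.
  have : k0 * \int[mu]_x H x <= c by rewrite ler_pM2l// (le_trans H2)// lerB.
  by rewrite -addrA lerDl subr_ge0.
apply: le_Rintegral => //.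
  by apply: section_integrable; [exact: evolve_regular ag nu0|exact: evolve_capped ag nu0].
move=> x _; rewrite /J /H indicE mem_setE in_itv/=.
have [/andP[x0 x1]|_] := boolP (0 <= x < 1); last first.
  rewrite mul0r !mulr0 subrr mulr0; exact: regular_ge0 (evolve_regular ag nu0) _ _.
have D : wedge t x by apply/wedgeP; rewrite x0 (le_trans (ltW x1)).
rewrite mul1r mulr1 -/(loss g t x) /evolve D /source x1.
apply: (@le_trans _ _ (delta * expR (- loss g t x))).
  rewrite -mulrA ler_pM2l// [X in _ <= expR X](_ : _ = - c + (c - loss g t x)); last by ring.
  by rewrite expRD ler_pM2l ?expR_gt0// (le_trans _ (expR_ge1Dx _))// addrA.
by rewrite ler_pM2r ?expR_gt0// gini_ge// x0 ltW.
Qed.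

Lemma pop_floor_gt0 : 0 < pop_floor.
Proof. by rewrite mulr_gt0 ?expR_gt0. Qed.

Lemma evolve_admissible nu g : admissible nu g -> 0 < nu -> admissible pop_floor (evolve g).
Proof.
move=> ag nu0; split; [exact: evolve_regular ag nu0|exact: evolve_capped ag nu0| |].
  move=> t /andP[t1 tT]; apply: (evolve_cont ag) => //; last by rewrite gt_eqF.
  by apply/wedgeP; rewrite ltW// tT lexx (le_trans _ (ltW t1)).
by move=> t tT; exact: evolve_population_ge ag nu0 tT.
Qed.

(** * Contraction in a weighted norm *)

Section Contraction.
Variables (nu : R) (g1 g2 : R -> R -> R) (D lam kap : R).
Hypotheses (a1 : admissible nu g1) (a2 : admissible nu g2) (nu0 : 0 < nu) (D0 : 0 <= D)
  (lam0 : 0 < lam) (kap1 : 1 <= kap)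
  (gD : forall t x, wedge t x ->
     `|g1 t x - g2 t x| <= D * expR (lam * t) * expR (kap * x)).

Let kap0 : 0 < kap. Proof. exact: lt_le_trans kap1. Qed.
Let p1 := admissible_regular a1.
Let p2 := admissible_regular a2.
Let c1 := admissible_capped a1.
Let c2 := admissible_capped a2.
Let M0 : 0 <= cap T := cap_ge0 T.
(* the integral over [0, t] of the weighted bound, by [le_integral_expR] *)
Let eps t := D * expR (lam * t) * (expR (kap * t) / kap).

Let eps_ge0 t : 0 <= eps t.
Proof. by rewrite !mulr_ge0 ?expR_ge0// invr_ge0 ltW. Qed.

Let W0 t : 0 <= D * expR (lam * t).
Proof. by rewrite mulr_ge0 ?expR_ge0. Qed.

Lemma dist_population t : 1 <= t <= T -> `|population g1 t - population g2 t| <= eps t.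
Proof.
move=> /andP[t1 tT]; rewrite /population -RintegralB//; try exact: section_integrable.
apply: le_integral_expR => //.
- by apply: measurable_funB; exact: section_measurable.
- exact: le_trans t1.
- by move=> x xt; apply: gD; apply/wedgeP; rewrite t1 tT.
- move=> x xt; have ND : ~~ wedge t x by apply: contra xt => /wedgeP[].
  by rewrite (regular_out p1 ND) (regular_out p2 ND) subrr.
Qed.

Lemma dist_prod (h : R -> R -> R) t : regular h -> capped h -> 1 <= t <= T ->
  `|\int[mu]_x ((g1 t x - g2 t x) * h t (t - x))| <= cap T * eps t.
Proof.
move=> ph ch /andP[t1 tT]; rewrite /eps mulrA.
apply: le_integral_expR => //.
- apply: measurable_funM; first by apply: measurable_funB; exact: section_measurable.
  by apply: measurableT_comp (measurable_reflect t); exact: section_measurable.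
- exact: le_trans t1.
- by rewrite mulr_ge0.
- move=> x xt; rewrite normrM mulrC -mulrA ler_pM//.
    by rewrite ger0_norm; [exact: capped_le|exact: regular_ge0].
  by apply: gD; apply/wedgeP; rewrite t1 tT.
- move=> x xt; have ND : ~~ wedge t x by apply: contra xt => /wedgeP[].
  by rewrite (regular_out p1 ND) (regular_out p2 ND) subrr mul0r.
Qed.

(** The pairing is a symmetric bilinear form, so the difference of its diagonal
    values at g1 and g2 factors as the pairing of g1 - g2 with g1 + g2. *)
Lemma dist_pairing t : 1 <= t <= T -> `|pairing g1 t - pairing g2 t| <= 2 * (cap T * eps t).
Proof.
move=> tT.
have -> : pairing g1 t - pairing g2 t = \int[mu]_x ((g1 t x - g2 t x) * g1 t (t - x)) +
    \int[mu]_x ((g1 t x - g2 t x) * g2 t (t - x)).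
  under [X in _ = X + _]eq_Rintegral do rewrite mulrBl.
  under [X in _ = _ + X]eq_Rintegral do rewrite mulrBl.
  rewrite !RintegralB//; try exact: pair_section_integrable.
  by rewrite (pair_section_sym t p2 c2 p1 c1) /pairing; ring.
by rewrite mulrDl !mul1r (le_trans (ler_normD _ _))// lerD// dist_prod.
Qed.

Let B0 : 0 <= (k0 + 1) * cap T / nu.
Proof. by rewrite divr_ge0 ?(ltW nu0)// mulr_ge0// addr_ge0// ltW. Qed.

(** The product N1 (B1 - B2) is a combination of the differences of the pairings
    and of the populations, and B2 <= cap T. *)
Lemma dist_newborn t : 1 <= t <= T -> `|newborn g1 t - newborn g2 t| <= (k0 + 1) * cap T / nu * eps t.
Proof.
move=> tT; have [t1 tT'] := andP tT.
have N1 := lt_le_trans nu0 (admissible_population a1 tT); have N2 := lt_le_trans nu0 (admissible_population a2 tT).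
have -> : newborn g1 t - newborn g2 t = (k0 / 2 * (pairing g1 t - pairing g2 t) +
    newborn g2 t * (population g2 t - population g1 t)) / population g1 t.
  by rewrite /newborn; field; rewrite !gt_eqF.
have N1nu : 1 <= population g1 t / nu by rewrite ler_pdivlMr// mul1r; exact: admissible_population a1 _ tT.
rewrite normrM normfV (ger0_norm (ltW N1)) ler_pdivrMr//.
have -> : (k0 + 1) * cap T / nu * eps t * population g1 t =
    (k0 + 1) * cap T * eps t * (population g1 t / nu) by field; rewrite gt_eqF.
apply: (@le_trans _ _ ((k0 + 1) * cap T * eps t)); last first.
  by rewrite ler_peMr// mulr_ge0// mulr_ge0// addr_ge0// ltW.
apply: (le_trans (ler_normD _ _)).
have -> : (k0 + 1) * cap T * eps t =
    k0 / 2 * (2 * (cap T * eps t)) + cap T * eps t by field.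
rewrite lerD//.
  rewrite normrM (@ger0_norm _ (k0 / 2)) ?divr_ge0 ?(ltW k0_gt0)//.
  by rewrite ler_pM2l ?divr_gt0// dist_pairing.
rewrite normrM ger0_norm ?newborn_ge0// distrC ler_pM ?newborn_ge0 ?dist_population//.
by rewrite (le_trans (newborn_cap _ _ _ _))// cap_mono.
Qed.

(* from g1/N1 - g2/N2 = (g1 - g2)/N1 + g2 (N2 - N1)/(N1 N2), with N1, N2 >= nu
   and g2 <= cap T *)
Let CE := nu^-1 + cap T / nu ^+ 2.

Let CE0 : 0 <= CE.
Proof. by rewrite addr_ge0// ?divr_ge0 ?exprn_ge0 ?invr_ge0 ?(ltW nu0). Qed.

(** In s the weight e^{lam s} is kept, while the weight in the size is bounded
    crudely: the constant may depend on kap, since lam is chosen after it. *)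
Lemma dist_loss_rate t x s : 0 <= x ->
  `|loss_rate g1 t x s - loss_rate g2 t x s| <= D * expR (kap * T) * CE * expR (lam * s).
Proof.
move=> x0; have R0 : 0 <= D * expR (kap * T) * CE * expR (lam * s).
  by rewrite !mulr_ge0 ?expR_ge0.
rewrite /loss_rate; case: ifP => st; last by rewrite subrr normr0.
have [Ds|Ds] := boolP (wedge s (s - x)); last first.
  by rewrite (regular_out p1 Ds) (regular_out p2 Ds) !mul0r subrr normr0.
have /wedgeP[sT /andP[sx _]] := Ds; have [s1 sT'] := andP sT.
have N1 := lt_le_trans nu0 (admissible_population a1 sT); have N2 := lt_le_trans nu0 (admissible_population a2 sT).
pose d := D * expR (lam * s) * expR (kap * T).
have d0 : 0 <= d by rewrite mulr_ge0 ?expR_ge0.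
have hg : `|g1 s (s - x) - g2 s (s - x)| <= d.
  apply: (le_trans (gD Ds)); rewrite ler_wpM2l// ler_expR ler_pM2l//; lra.
have hN : `|population g2 s - population g1 s| <= d.
  rewrite distrC (le_trans (dist_population sT))// ler_wpM2l//.
  rewrite ler_pdivrMr// -[leLHS]mulr1 ler_pM ?expR_ge0// ler_expR.
  by rewrite ler_pM2l.
have hi1 : (population g1 s)^-1 <= nu^-1 by rewrite lef_pV2 ?posrE//; exact: admissible_population a1 _ sT.
have hi2 : (population g2 s)^-1 <= nu^-1 by rewrite lef_pV2 ?posrE//; exact: admissible_population a2 _ sT.
have hg2 : 0 <= g2 s (s - x) <= cap T by rewrite regular_ge0//= capped_le.
have -> : g1 s (s - x) / population g1 s - g2 s (s - x) / population g2 s =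
  (g1 s (s - x) - g2 s (s - x)) * (population g1 s)^-1 +
  g2 s (s - x) * (population g2 s - population g1 s) * ((population g1 s)^-1 * (population g2 s)^-1).
  by field; rewrite !gt_eqF.
have -> : D * expR (kap * T) * CE * expR (lam * s) =
   d * nu^-1 + cap T * d * (nu^-1 * nu^-1).
  by rewrite /CE /d; field; rewrite gt_eqF.
apply: (le_trans (ler_normD _ _)); rewrite !normrM !normfV.
rewrite (ger0_norm (ltW N1)) (ger0_norm (ltW N2)) (ger0_norm (regular_ge0 p2 _ _)).
have [g20 g2M] := andP hg2.
have i1 : 0 <= (population g1 s)^-1 by rewrite invr_ge0 ltW.
have i2 : 0 <= (population g2 s)^-1 by rewrite invr_ge0 ltW.
by rewrite lerD// ler_pM// ?mulr_ge0// ler_pM.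
Qed.

Lemma dist_loss t x : wedge t x ->
  `|loss g1 t x - loss g2 t x| <= k0 * (D * expR (kap * T) * CE * (expR (lam * t) / lam)).
Proof.
move=> Dtx; have /wedgeP[/andP[t1 tT] /andP[x0 xt]] := Dtx.
rewrite /loss -mulrBr normrM (ger0_norm (ltW k0_gt0)) ler_pM2l//.
have I1 := loss_rate_integrable t p1 c1 nu0 (fun t tT => admissible_population a1 tT) (fun _ : x = 0 => admissible_diag a1).
have I2 := loss_rate_integrable t p2 c2 nu0 (fun t tT => admissible_population a2 tT) (fun _ : x = 0 => admissible_diag a2).
rewrite -RintegralB//; apply: le_integral_expR => //.
- by apply: measurable_funB; apply: loss_rate_measurable => // _; [exact: admissible_diag a1|exact: admissible_diag a2].
- exact: le_trans t1.
- by rewrite !mulr_ge0 ?expR_ge0.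
- by move=> s _; exact: dist_loss_rate.
- move=> s st; have h : ~~ [&& 1 <= s, s <= T, x <= s & s <= t].
    by apply: contra st => /and4P[s1 _ _ ->]; rewrite andbT (le_trans _ s1).
  by rewrite (loss_rate_out p1 h) (loss_rate_out p2 h) subrr.
Qed.

Lemma dist_evolve t x : wedge t x -> `|evolve g1 t x - evolve g2 t x| <=
  D * expR (lam * t) * expR (kap * x) *
  ((k0 + 1) * cap T / nu / kap + cap T * (k0 * CE * expR (kap * T)) / lam).
Proof.
move=> Dtx; have /wedgeP[/andP[t1 tT] /andP[x0 xt]] := Dtx.
rewrite /evolve Dtx.
have b2 : 0 <= source g2 x <= cap T.
  rewrite source_ge0// (le_trans (source_cap a2 nu0 _))// ?x0 ?(le_trans xt)//.
  by rewrite cap_mono// (le_trans xt).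
have [b20 b2M] := andP b2.
have E1 := loss_ge0 t x p1; have E2 := loss_ge0 t x p2.
have -> : source g1 x * expR (- loss g1 t x) - source g2 x * expR (- loss g2 t x) =
  (source g1 x - source g2 x) * expR (- loss g1 t x) +
  source g2 x * (expR (- loss g1 t x) - expR (- loss g2 t x)).
  by rewrite mulrBl mulrBr addrA subrK.
apply: (le_trans (ler_normD _ _)); rewrite [leRHS]mulrDr lerD//.
  rewrite normrM (ger0_norm (expR_ge0 _)) -[leRHS]mulr1 ler_pM ?expR_ge0 ?expRN_le1//.
  rewrite /source; case: ltP => x1.
    have A0 : 0 <= (k0 + 1) * cap T / nu / kap by rewrite divr_ge0 ?(ltW kap0).
    by rewrite subrr normr0 mulr_ge0// mulr_ge0 ?expR_ge0.
  have xT : 1 <= x <= T by rewrite x1 (le_trans xt).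
  apply: (le_trans (dist_newborn xT)).
  have -> : D * expR (lam * t) * expR (kap * x) * ((k0 + 1) * cap T / nu / kap) =
    (k0 + 1) * cap T / nu * (D * expR (lam * t) * (expR (kap * x) / kap)).
    by field; rewrite !gt_eqF.
  rewrite ler_wpM2l// /eps ler_wpM2r ?divr_ge0 ?expR_ge0 ?(ltW kap0)//.
  by rewrite ler_wpM2l// ler_expR ler_pM2l.
rewrite normrM (ger0_norm b20).
apply: (@le_trans _ _ (cap T * (k0 * (D * expR (kap * T) * CE * (expR (lam * t) / lam))))).
  by rewrite ler_pM// (le_trans (expRN_lipschitz E1 E2))// dist_loss.
have -> : D * expR (lam * t) * expR (kap * x) * (cap T * (k0 * CE * expR (kap * T)) / lam) =
  cap T * (k0 * (D * expR (kap * T) * CE * (expR (lam * t) / lam))) * expR (kap * x).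
  by field; rewrite gt_eqF.
apply: ler_peMr; last by rewrite -expR0 ler_expR mulr_ge0// ltW.
apply: mulr_ge0 => //; apply: mulr_ge0; first exact: ltW.
by rewrite !mulr_ge0 ?expR_ge0 ?invr_ge0 ?(ltW lam0).
Qed.

End Contraction.

(** Each of the two terms of [dist_evolve] is made at most a quarter:
    the first by the choice of kap, and the second, whose constant depends on
    kap, by the choice of lam. *)
Lemma evolve_contraction nu : 0 < nu -> exists lam kap : R, 0 <= lam /\ 0 <= kap /\
  forall (g1 g2 : R -> R -> R) (D : R), admissible nu g1 -> admissible nu g2 -> 0 <= D ->
  (forall t x, wedge t x ->
     `|g1 t x - g2 t x| <= D * expR (lam * t) * expR (kap * x)) ->
  (forall t x, wedge t x ->
     `|evolve g1 t x - evolve g2 t x| <= D / 2 * expR (lam * t) * expR (kap * x)).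
Proof.
move=> nu0.
pose CB := (k0 + 1) * cap T / nu.
have CB0 : 0 <= CB by rewrite divr_ge0 ?(ltW nu0)// mulr_ge0 ?cap_ge0// addr_ge0// ltW.
pose kap := 4 * CB + 1.
pose CL := cap T * (k0 * (nu^-1 + cap T / nu ^+ 2) * expR (kap * T)).
have CL0 : 0 <= CL.
  rewrite mulr_ge0 ?cap_ge0// mulr_ge0 ?expR_ge0// mulr_ge0 ?(ltW k0_gt0)//.
  by rewrite addr_ge0 ?divr_ge0 ?invr_ge0 ?cap_ge0 ?exprn_ge0 ?(ltW nu0).
pose lam := 4 * CL + 1.
have kap1 : 1 <= kap by rewrite lerDr mulr_ge0.
have lam0 : 0 < lam by rewrite ltr_wpDl// mulr_ge0.
exists lam, kap; split; [exact: ltW|split; first exact: le_trans kap1].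
move=> g1 g2 D a1 a2 D0 gD t x Dtx.
apply: (le_trans (dist_evolve a1 a2 nu0 D0 lam0 kap1 gD Dtx)).
rewrite -/CB -/CL.
have h1 : CB / kap <= 1 / 4 by rewrite ler_pdivrMr ?(lt_le_trans ltr01 kap1)// /kap; lra.
have h2 : CL / lam <= 1 / 4 by rewrite ler_pdivrMr// /lam; lra.
have -> : D / 2 * expR (lam * t) * expR (kap * x) =
  D * expR (lam * t) * expR (kap * x) * (1 / 2) by field.
rewrite ler_wpM2l ?mulr_ge0 ?expR_ge0//; lra.
Qed.

(** * Fixed points *)

Lemma evolve_fixed_unique nu g1 g2 : 0 < nu -> admissible nu g1 -> admissible nu g2 ->
  (forall t x, wedge t x -> g1 t x = evolve g1 t x) ->
  (forall t x, wedge t x -> g2 t x = evolve g2 t x) ->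
  forall t x, wedge t x -> g1 t x = g2 t x.
Proof.
move=> nu0 a1 a2 f1 f2 t x Dtx.
have [lam [kap [lam0 [kap0 h]]]] := evolve_contraction nu0.
have hn n : forall t x, wedge t x ->
    `|g1 t x - g2 t x| <= cap T / 2 ^+ n * expR (lam * t) * expR (kap * x).
  elim: n => [|n IH] s y Dsy.
    have /wedgeP[/andP[s1 _] /andP[y0 _]] := Dsy.
    have b1 := capped_le s y (admissible_regular a1) (admissible_capped a1); have b2 := capped_le s y (admissible_regular a2) (admissible_capped a2).
    have p1 := regular_ge0 (admissible_regular a1) s y; have p2 := regular_ge0 (admissible_regular a2) s y.
    rewrite expr0 divr1 (@le_trans _ _ (cap T))//; first by rewrite ler_norml; lra.
    rewrite -mulrA ler_peMr ?cap_ge0// -expRD -expR0 ler_expR.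
    by rewrite addr_ge0// mulr_ge0// (le_trans _ s1).
  rewrite (f1 _ _ Dsy) (f2 _ _ Dsy) exprSr invfM mulrA.
  by apply: h => //; rewrite divr_ge0 ?cap_ge0 ?exprn_ge0.
apply/eqP; rewrite -subr_eq0; apply/eqP.
apply: (@geo_eq0 _ _ (cap T * (expR (lam * t) * expR (kap * x)))) => n.
apply: (le_trans (hn n _ _ Dtx)).
by rewrite le_eqVlt; apply/orP; left; apply/eqP; ring.
Qed.

Lemma cap_delta x : 0 <= x -> delta <= cap x.
Proof.
move=> x0; have h01 : 0 <= (0 : R) <= 1 by rewrite lexx ler01.
rewrite (le_trans (gini_ge h01))// (le_trans (gini_le h01))// ler_peMr ?(ltW K_gt0)//.
by rewrite -expR0 ler_expR !mulr_ge0// ltW.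
Qed.

Definition first_guess t x := if wedge t x then delta else 0.

Lemma first_guess_admissible : admissible pop_floor first_guess.
Proof.
have sc t x : wedge t x -> wedge_cont first_guess t x.
  move=> D u v uvD ut vx; rewrite /first_guess D.
  apply: cvg_near_cst; near=> n; rewrite ifT//.
  by near: n.
have ps : regular first_guess.
  split => [t x D|t x|t x D _ _]; [by rewrite /first_guess (negbTE D)| |exact: sc].
  by rewrite /first_guess; case: ifP => // _; exact: ltW.
have cs : capped first_guess.
  by move=> t x D; rewrite /first_guess D cap_delta//; case/wedgeP : D => _ /andP[].
split => //.
  move=> t /andP[t1 tT]; apply: sc.
  by apply/wedgeP; rewrite ltW// tT lexx (le_trans _ (ltW t1)).
move=> t tT; have [t1 tT'] := andP tT.
apply: (@le_trans _ _ (\int[mu]_x (delta * \1_(`[0, 1]) x))).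
  rewrite RintegralZl//; last exact: (@integrable_indic_itv R 0 1 true false).
  rewrite /Rintegral integral_indic// setIT; have := @lebesgue_measure_itv R `[0, 1] => /= ->.
  rewrite lte_fin ltr01/= subr0 ler_pM2l// expRN_le1//.
  by rewrite mulr_ge0 ?subr_ge0 ?(ltW k0_gt0) ?(ltW T_gt1).
apply: le_Rintegral => //.
- exact: (integrableZl _ _ (@integrable_indic_itv R 0 1 true false)).
- exact: section_integrable.
move=> x _; rewrite indicE mem_setE in_itv/= /first_guess.
have [/andP[x0 x1]|_] := boolP (0 <= x <= 1).
  by rewrite mulr1 ifT//; apply/wedgeP; rewrite x0 (le_trans x1).
by rewrite mulr0; case: ifP => // _; exact: ltW.
Unshelve. all: by end_near. Qed.

Definition picard n := iter n evolve first_guess.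

Lemma picard_admissible n : admissible pop_floor (picard n).
Proof.
elim: n => [|n IH]; first exact: first_guess_admissible.
exact: evolve_admissible IH pop_floor_gt0.
Qed.

(** Every clause passes to uniform limits: continuity by the usual three
    epsilons, and the bound on the population by dominated convergence. *)
Lemma admissible_limit nu (gs : nat -> R -> R -> R) g (C : R) :
  (forall n, admissible nu (gs n)) ->
  (forall t x, ~~ wedge t x -> g t x = 0) ->
  (forall n t x, wedge t x -> `|gs n t x - g t x| <= C / 2 ^+ n) ->
  admissible nu g.
Proof.
move=> ags g0 hg.
have C0 : 0 <= C.
  have D : wedge 1 0 by apply/wedgeP; rewrite !lexx ler01 ltW.
  by have := hg 0%N _ _ D; rewrite expr0 divr1; exact: le_trans.
have e0 := @geo_cvg0 R C.
have hg' n t x : `|gs n t x - g t x| <= C / 2 ^+ n.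
  have [/hg //|D] := boolP (wedge t x).
  by rewrite g0// (regular_out (admissible_regular (ags n)) D) subrr normr0 divr_ge0// exprn_ge0.
have gcv t x : gs n t x @[n --> \oo] --> g t x.
  apply/cvgrPdist_le => e e_gt0.
  have /cvgrPdist_lt/(_ e e_gt0) := e0; apply: filterS => n /=.
  rewrite sub0r normrN => he; rewrite distrC (le_trans (hg' n t x))//.
  by rewrite ltW// (le_lt_trans (ler_norm _)).
have scg t x : (forall n, wedge_cont (gs n) t x) -> wedge_cont g t x.
  move=> h u v uvD ut vx; apply/cvgrPdist_lt => e e_gt0.
  have e3 : 0 < e / 3 by rewrite divr_gt0.
  have /cvgrPdist_lt/(_ _ e3)[n _ /(_ n (leqnn n))] := e0.
  rewrite /= sub0r normrN => hn.
  have {}hn s y : `|gs n s y - g s y| < e / 3.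
    by apply: le_lt_trans (hg' n s y) _; apply: le_lt_trans hn; exact: ler_norm.
  have /cvgrPdist_lt/(_ _ e3) := h n u v uvD ut vx.
  apply: filterS => k hk.
  have := hn t x; have := hn (u k) (v k); move: hk; rewrite !ltr_norml; lra.
have pg : regular g.
  split => // [t x|t x D x1 xt].
    apply: (cvgr_to_ge (gcv t x)); apply: nearW => n; exact: regular_ge0 (admissible_regular (ags n)) t x.
  apply: scg => n; exact: (regular_cont (admissible_regular (ags n))).
have cg : capped g.
  move=> t x D; apply: (cvgr_to_le (gcv t x)); apply: nearW => n.
  exact: admissible_capped (ags n) _ _ D.
split=> // [t tT|t tT].
  by apply: scg => n; exact: (admissible_diag (ags n)).
have : population (gs n) t @[n --> \oo] --> population g t.
  apply: (@dominated_cvg_off _ [::] T (cap T)).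
  - by move=> n; apply: section_measurable; exact: admissible_regular (ags n).
  - exact: section_measurable.
  - by move=> n; apply: section_bsupp; [exact: admissible_regular (ags n)|exact: admissible_capped (ags n)].
  - by move=> x _; exact: gcv.
by move=> h; apply: (cvgr_to_ge h); apply: nearW => n; exact: admissible_population (ags n) _ tT.
Qed.

(** The iterates converge geometrically, uniformly on the wedge; their limit is
    admissible, so that the contraction compares its image with the images of
    the iterates. *)
Lemma evolve_fixed_exists : exists g, admissible pop_floor g /\ forall t x, g t x = evolve g t x.
Proof.
have [lam [kap [lam0 [kap0 h]]]] := evolve_contraction pop_floor_gt0.
pose C := cap T * (expR (lam * T) * expR (kap * T)).
have C0 : 0 <= C by rewrite mulr_ge0 ?cap_ge0// mulr_ge0 ?expR_ge0.
have hn n : forall t x, wedge t x -> `|picard n.+1 t x - picard n t x| <=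
    cap T / 2 ^+ n * expR (lam * t) * expR (kap * x).
  elim: n => [|n IH] s y Dsy.
    have /wedgeP[/andP[s1 _] /andP[y0 _]] := Dsy.
    have a1 := picard_admissible 1; have a2 := picard_admissible 0.
    have b1 := capped_le s y (admissible_regular a1) (admissible_capped a1); have b2 := capped_le s y (admissible_regular a2) (admissible_capped a2).
    have p1 := regular_ge0 (admissible_regular a1) s y; have p2 := regular_ge0 (admissible_regular a2) s y.
    rewrite expr0 divr1 (@le_trans _ _ (cap T))//; first by rewrite ler_norml; lra.
    rewrite -mulrA ler_peMr ?cap_ge0// -expRD -expR0 ler_expR.
    by rewrite addr_ge0// mulr_ge0// (le_trans _ s1).
  rewrite exprSr invfM mulrA; apply: (h (picard n.+1) (picard n)) => //.
  - exact: picard_admissible.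
  - exact: picard_admissible.
  - by rewrite divr_ge0 ?cap_ge0 ?exprn_ge0.
have hC n t x : `|picard n.+1 t x - picard n t x| <= C / 2 ^+ n.
  have [D|D] := boolP (wedge t x); last first.
    rewrite (regular_out (admissible_regular (picard_admissible n.+1)) D) (regular_out (admissible_regular (picard_admissible n)) D).
    by rewrite subrr normr0 divr_ge0 ?exprn_ge0.
  have /wedgeP[/andP[_ tT] /andP[_ xt]] := D.
  apply: (le_trans (hn n _ _ D)); rewrite -mulrA /C mulrAC ler_wpM2r ?invr_ge0 ?exprn_ge0//.
  rewrite ler_wpM2l ?cap_ge0// ler_pM ?expR_ge0// ler_expR ler_wpM2l//.
  exact: le_trans tT.
pose l t x := projT1 (cid2 (cvg_geo (hC ^~ t ^~ x))).
have ler n t x : `|picard n t x - l t x| <= 2 * C / 2 ^+ n by rewrite /l; case: cid2.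
have al : admissible pop_floor l.
  apply: (admissible_limit (C := 2 * C) picard_admissible) => // t x D.
  apply: (@geo_eq0 _ _ (2 * C)) => n; have := ler n t x.
  by rewrite (regular_out (admissible_regular (picard_admissible n)) D) sub0r normrN.
exists l; split => // t x.
have [D|D] := boolP (wedge t x); last first.
  by rewrite (regular_out (admissible_regular al) D) (regular_out (evolve_regular al pop_floor_gt0) D).
pose w := expR (lam * t) * expR (kap * x).
apply/eqP; rewrite -subr_eq0; apply/eqP/(@geo_eq0 _ _ (2 * C + 2 * C * w)) => n.
have h1 := ler n.+1 t x.
have C20 : 0 <= 2 * C by rewrite mulr_ge0.
have h20 : 0 <= 2 * C / 2 ^+ n by rewrite divr_ge0 ?exprn_ge0.
have hw s y : wedge s y -> `|picard n s y - l s y| <=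
    2 * C / 2 ^+ n * expR (lam * s) * expR (kap * y).
  move=> /wedgeP[/andP[s1 _] /andP[y0 _]]; apply: (le_trans (ler n s y)).
  rewrite -[leRHS]mulrA ler_peMr// -expRD -expR0 ler_expR.
  by rewrite addr_ge0// mulr_ge0// (le_trans _ s1).
have h2 := h _ _ _ (picard_admissible n) al h20 hw _ _ D.
have e : picard n.+1 t x = evolve (picard n) t x by [].
move: h1 h2; rewrite e; move: (evolve (picard n) t x) (l t x) (evolve l t x) => a b c h1 h2.
rewrite -(subrKA a) (le_trans (ler_normD _ _))// distrC.
apply: (le_trans (lerD h1 h2)); rewrite [leRHS]mulrDl; apply: lerD.
  rewrite ler_wpM2l// lef_pV2 ?posrE ?exprn_gt0// exprS ler_peMl ?exprn_ge0//.
  by rewrite ler1n.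
have -> : 2 * C * w / 2 ^+ n = 2 * C / 2 ^+ n * w by rewrite mulrAC.
rewrite -[leLHS]mulrA -/w ler_wpM2r ?mulr_ge0 ?expR_ge0//.
by rewrite ler_piMr// invf_le1// ler1n.
Qed.

(** * Fixed points are mild solutions *)

Lemma OmegaP t x : Omega T (t, x) <-> (1 <= t <= T) /\ (0 <= x <= T).
Proof. by rewrite /Omega/= !in_itv. Qed.

Lemma wedge_Omega t x : wedge t x -> Omega T (t, x).
Proof.
move=> /wedgeP[tT /andP[x0 xt]]; apply/OmegaP; split => //.
by rewrite x0 (le_trans xt)//; case/andP : tT.
Qed.

(** The extended-real quantities attached to h are those of g when the two agree
    on the domain, as none of them reads a value outside it. This serves in both
    directions: for a fixed point g, and for a mild solution h cut to the
    wedge. *)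
Section Agree.
Variables (nu : R) (h : R * R -> R) (g : R -> R -> R).
Hypotheses (pg : regular g) (cg : capped g) (nu0 : 0 < nu)
  (gN : forall t, 1 <= t <= T -> nu <= population g t)
  (hg : forall t x, Omega T (t, x) -> h (t, x) = g t x).

Lemma N_integral t : 1 <= t <= T -> N h t = (\int[mu]_x (g t x)%:E)%E.
Proof.
move=> tT; rewrite -(@integral_supp R `[0, t]).
  apply: eq_integral => x; rewrite inE/= in_itv/= => /andP[x0 xt]; congr EFin.
  by apply: hg; apply/OmegaP; rewrite x0 (le_trans xt)//; case/andP : tT.
by move=> x xt; apply: (regular_out pg); apply/wedgeP => -[_ h1]; apply: xt; rewrite /= in_itv.
Qed.

Lemma N_population t : 1 <= t <= T -> N h t = (population g t)%:E.
Proof.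
move=> tT; rewrite N_integral// /population /Rintegral fineK//.
exact: integrable_fin_num (section_integrable t pg cg).
Qed.

Lemma B_integral t : 1 <= t <= T ->
  (\int[mu]_(x in `[0%R, t]) (h (t, x) * h (t, (t - x)%R))%:E =
   \int[mu]_x (g t x * g t (t - x)%R)%:E)%E.
Proof.
move=> tT; rewrite -(@integral_supp R `[0, t]).
  apply: eq_integral => x; rewrite inE/= in_itv/= => /andP[x0 xt]; congr EFin.
  have tT' : t <= T by case/andP : tT.
  by rewrite !hg//; apply/OmegaP; split => //; rewrite ?subr_ge0 ?xt ?x0/=; lra.
move=> x xt; rewrite (regular_out pg) ?mul0r//.
by apply/wedgeP => -[_ h1]; apply: xt; rewrite /= in_itv.
Qed.

Lemma B_newborn t : 1 <= t <= T -> B k0 h t = (newborn g t)%:E.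
Proof.
move=> tT; have fQ : (\int[mu]_x (g t x * g t (t - x)%R)%:E = (pairing g t)%:E)%E.
  rewrite /pairing /Rintegral fineK//.
  exact: integrable_fin_num (pair_section_integrable t pg cg pg cg).
by rewrite /B N_population// B_integral// fQ.
Qed.

(** The condition on a says that it is the time at which a particle of size x
    appears, the starting point of the integrals in [Gamma]. *)
Lemma decay_loss a t x : wedge t x -> (x = 0 -> diag_cont g) ->
  a = (if x < 1 then 1 else x) -> decay k0 h a t x = (expR (- loss g t x))%:E.
Proof.
move=> Dtx dg aE; have /wedgeP[/andP[t1 tT] /andP[x0 xt]] := Dtx.
have a1 : 1 <= a by rewrite aE; case: ltP.
have ax : x <= a by rewrite aE; case: ltP => // /ltW.
rewrite /decay; set I := (\int[mu]_(s in _) _)%E.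
suff -> : I = (\int[mu]_s (loss_rate g t x s)%:E)%E.
  rewrite -[X in (_ * X)%E]fineK; last first.
    exact: integrable_fin_num (loss_rate_integrable t pg cg nu0 gN dg).
  by rewrite -EFinM -EFinN.
rewrite -(@integral_supp R `[a, t]).
  apply: eq_integral => s; rewrite inE/= in_itv/= => /andP[sa st]; congr EFin.
  have s1 := le_trans a1 sa; have sT := le_trans st tT; have sx := le_trans ax sa.
  rewrite /loss_rate st N_population ?s1//= hg//; apply/OmegaP; rewrite s1 sT; split => //.
  by rewrite subr_ge0 sx/=; lra.
move=> s st; apply: (loss_rate_out pg); apply/and4P => -[h1 _ h2 h3]; apply: st.
by rewrite /= in_itv/= h3 andbT aE; case: ifP.
Qed.

Lemma Gamma_evolve t x : wedge t x -> (x = 0 -> diag_cont g) ->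
  Gamma k0 gini h t x = (evolve g t x)%:E.
Proof.
move=> Dtx dg; have /wedgeP[/andP[t1 tT] /andP[x0 xt]] := Dtx.
rewrite /Gamma /evolve Dtx /source; case: ifPn => x1.
  by rewrite decay_loss ?x1.
rewrite xt B_newborn; last by rewrite leNgt x1 (le_trans xt).
by rewrite decay_loss// (negbTE x1).
Qed.

End Agree.

Lemma fixed_mild g : admissible pop_floor g -> (forall t x, g t x = evolve g t x) ->
  mild_solution k0 gini T (fun p => g p.1 p.2).
Proof.
move=> ag fg; have [pg cg dg gN] := ag.
have N0 t : 1 <= t <= T -> 0 < population g t by move=> /gN; exact: lt_le_trans pop_floor_gt0.
split.
- split.
  + by move=> p _; exact: regular_ge0.
  + move=> x /andP[x0 x1]; rewrite /= fg /evolve.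
    have D : wedge 1 x by apply/wedgeP; rewrite lexx x0 !ltW.
    rewrite D /source x1 (_ : loss g 1 x = 0) ?oppr0 ?expR0 ?mulr1//.
    apply/le_anti; rewrite loss_ge0// andbT.
    by rewrite (le_trans (loss_le (a := 1) pg cg pop_floor_gt0 gN _ _ _)) ?lexx ?orbT// subrr !mulr0.
  + by move=> t x _ tx; rewrite /= (regular_out pg)//; apply/wedgeP => -[_ /andP[_]]; rewrite leNgt tx.
  + move=> t x /OmegaP[tT /andP[x0 xT]] x1 xt.
    apply: (@cvg_seq_within R) => u v uvO /= ut vx.
    have [xt'|tx|xt'] := ltgtP x t; last by rewrite xt' eqxx in xt.
      apply: (regular_cont pg) => //; first by apply/wedgeP; rewrite tT x0 (ltW xt').
      have uvtx : u n - v n @[n --> \oo] --> t - x by exact: cvgB.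
      near=> n; have /OmegaP[h1 /andP[h2 _]] := uvO n; apply/wedgeP; split => //.
      rewrite h2 -subr_ge0; apply: ltW; near: n; apply: cvgr_gt uvtx _ _.
      by rewrite subr_gt0.
    rewrite (regular_out pg); last by apply/wedgeP => -[_ /andP[_]]; rewrite leNgt tx.
    by apply: (regular_cvg0 pg ut vx); rewrite tx !orbT.
- move=> t tT; rewrite (N_population pg cg _ tT)// (B_newborn pg cg _ tT)//.
  by rewrite lte_fin N0// !ltry.
- move=> t x /OmegaP[tT /andP[x0 xT]].
  have [xt|tx] := leP x t.
    have D : wedge t x by apply/wedgeP; rewrite x0.
    by rewrite (Gamma_evolve pg cg pop_floor_gt0 gN)// -fg.
  rewrite /= (regular_out pg); last by apply/wedgeP => -[_ /andP[_]]; rewrite leNgt tx.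
  by rewrite /Gamma leNgt tx/= ltNge (le_trans _ (ltW tx))//; case/andP : tT.
Unshelve. all: by end_near. Qed.

(** * Mild solutions are admissible *)

Section Mild.
Variable h : R * R -> R.
Hypothesis mh : mild_solution k0 gini T h.

(** The values of h outside the domain are arbitrary, hence the cut. *)
Definition trim t x := if wedge t x then h (t, x) else 0.

Lemma trim_Omega t x : Omega T (t, x) -> h (t, x) = trim t x.
Proof.
move=> O; have [[_ _ h0 _] _ _] := mh; rewrite /trim; case: ifPn => // D.
apply: h0 => //; rewrite ltNge; apply: contra D => xt.
by have /OmegaP[tT /andP[x0 _]] := O; apply/wedgeP; rewrite x0.
Qed.

Lemma trim_regular : regular trim.
Proof.
have [[hge _ _ hc] _ _] := mh; split.
- by move=> t x D; rewrite /trim (negbTE D).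
- by move=> t x; rewrite /trim; case: ifP => // /wedge_Omega; exact: hge.
- move=> t x D x1 xt u v uvD ut vx; rewrite [trim t x]/trim D.
  have := hc _ _ (wedge_Omega D) x1 xt => hw.
  have : h (u n, v n) @[n --> \oo] --> h (t, x).
    apply: cvg_comp hw => A; rewrite /within/= => wA.
    have uvc : (u n, v n) @[n --> \oo] --> (t, x) by exact: (cvg_pair ut vx).
    by have := uvc _ wA; apply: filterS2 uvD => n /wedge_Omega Dn; exact.
  apply: cvg_trans; apply: near_eq_cvg; near=> n; rewrite /trim ifT//.
  by near: n.
Unshelve. all: by end_near. Qed.

(** Integrability of the loss rate is not known yet: the extended-real exponent
    is only nonnegative, and infinite losses give a factor 0. *)
Lemma decay_01 a t x : wedge t x -> 1 <= a -> x <= a -> (0 <= decay k0 h a t x <= 1)%E.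
Proof.
move=> D a1 xa; have /wedgeP[/andP[_ tT] /andP[x0 xt]] := D.
have [[hge _ _ _] hN _] := mh.
apply: expeR_le1; apply: mule_ge0; first by rewrite lee_fin ltW.
apply: integral_ge0 => s; rewrite /= in_itv/= => /andP[sa st].
have s1 := le_trans a1 sa; have sx := le_trans xa sa.
rewrite lee_fin divr_ge0//.
  by apply: hge; apply/OmegaP; split; lra.
by apply: fine_ge0; have [/andP[/ltW]] := hN s ltac:(lra).
Qed.

Lemma mild_le_cap t x : wedge t x -> x < 1 -> h (t, x) <= cap x.
Proof.
move=> D x1; have [_ _ hG] := mh; have /wedgeP[/andP[t1 _] /andP[x0 _]] := D.
have x01 : 0 <= x <= 1 by rewrite x0 ltW.
have := hG _ _ (wedge_Omega D); rewrite /Gamma x1 => e.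
have /andP[_ d1] := decay_01 D (lexx 1) (ltW x1).
have g0 : 0 <= gini x by rewrite (le_trans (ltW delta_gt0))// gini_ge.
rewrite (le_trans _ (_ : gini x <= cap x))//.
  by rewrite -lee_fin -e -[leRHS]mule1; apply: lee_wpmul2l => //; rewrite lee_fin.
rewrite (le_trans (gini_le x01))// ler_peMr ?(ltW K_gt0)//.
by rewrite -expR0 ler_expR !mulr_ge0// ltW.
Qed.

Lemma mild_le_newborn t x : wedge t x -> 1 <= x -> ((h (t, x))%:E <= B k0 h x)%E.
Proof.
move=> D x1; have [[hge _ _ _] hN hG] := mh; have /wedgeP[/andP[t1 tT] /andP[x0 xt]] := D.
have := hG _ _ (wedge_Omega D); rewrite /Gamma ltNge x1/= xt => <-.
have /andP[_ d1] := decay_01 D x1 (lexx x).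
rewrite -[leRHS]mule1; apply: lee_wpmul2l => //.
have xT : 1 <= x <= T by rewrite x1 (le_trans xt).
have [/andP[/ltW N0 _] _] := hN x xT.
apply: mule_ge0.
  by rewrite lee_fin divr_ge0 ?(ltW k0_gt0)// mulr_ge0// fine_ge0.
apply: integral_ge0 => y; rewrite /= in_itv/= => /andP[y0 yx].
by rewrite lee_fin mulr_ge0//; apply: hge; apply/OmegaP; split; lra.
Qed.

(** The estimate of [newborn_cap] in the extended reals, from a bound on sizes up
    to x/2 only: finiteness of N is the sole integrability that is known. *)
Lemma mild_newborn_le x : 1 <= x <= T ->
  (forall y, 0 <= y <= x / 2 -> trim x y <= cap (x / 2)) ->
  (B k0 h x <= (k0 * cap (x / 2))%:E)%E.
Proof.
move=> xT hy; have [_ hN _] := mh; have [/andP[N0 Noo] _] := hN x xT.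
have pc := trim_regular.
have mx : measurable_fun setT (EFin \o trim x) by apply/measurable_EFinP; exact: section_measurable.
have mr : measurable_fun setT (fun y : R => (trim x (x - y))%:E).
  by apply/measurable_EFinP; apply: measurableT_comp (measurable_reflect x); exact: section_measurable.
have x0 y : (0 <= (EFin \o trim x) y)%E by rewrite lee_fin; exact: regular_ge0.
have r0 y : (0 <= (trim x (x - y)%R)%:E)%E by rewrite lee_fin; exact: regular_ge0.
have Q : (\int[mu]_y (trim x y * trim x (x - y)%R)%:E <=
    (cap (x / 2))%:E * (N h x + N h x))%E.
  pose s (y : R) : \bar R := ((EFin \o trim x) y + (trim x (x - y)%R)%:E)%E.
  have ms : measurable_fun setT s by exact: emeasurable_funD.
  have s0 y : (0 <= s y)%E by rewrite adde_ge0.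
  have -> : (N h x + N h x = \int[mu]_y s y)%E.
    rewrite ge0_integralD//; congr (_ + _)%E; rewrite (N_integral pc trim_Omega xT)//.
    by rewrite -[LHS](ge0_integral_reflect x mx x0).
  rewrite -(@ge0_integralZl _ _ _ mu setT measurableT s ms)//; last by rewrite lee_fin cap_ge0.
  apply: ge0_le_integral => //.
  - by move=> y _; rewrite lee_fin mulr_ge0//; exact: regular_ge0.
  - by apply/measurable_EFinP; exact: pair_section_measurable.
  - exact: measurable_funeM.
  move=> y _; rewrite /s /= -EFinD -EFinM lee_fin.
  have g0 := regular_ge0 pc x y; have g0' := regular_ge0 pc x (x - y).
  have c0 := cap_ge0 (x / 2).
  have [D|/(regular_out pc) e] := boolP (wedge x y); last first.
    by rewrite e mul0r mulr_ge0// addr_ge0.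
  have /wedgeP[_ /andP[y0 yx]] := D.
  have [yx2|yx2] := leP y (x / 2).
    by have := hy y ltac:(lra); nra.
  by have := hy (x - y) ltac:(lra); nra.
rewrite /B (B_integral pc trim_Omega xT).
have Nfin : N h x \is a fin_num by rewrite ge0_fin_numE// ltW.
have f0 : 0 < fine (N h x) by rewrite fine_gt0// N0 Noo.
apply: (@le_trans _ _ ((k0 / (2 * fine (N h x)))%:E * ((cap (x / 2))%:E * (N h x + N h x)))%E).
  apply: lee_wpmul2l => //.
  by rewrite lee_fin divr_ge0 ?(ltW k0_gt0)// mulr_ge0// ltW.
rewrite -(fineK Nfin) -EFinD -!EFinM lee_fin.
move: (fine (N h x)) f0 (cap (x / 2)) => n n0 c /=.
have -> : n + n = 2 * n by rewrite mulr_natl mulr2n.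
by rewrite [c * _]mulrC mulrA divfK// gt_eqF// mulr_gt0.
Qed.

(** Induction on the n with x < 2^n: births of size x involve a partner of size
    at most x/2, to which the induction hypothesis applies. *)
Lemma trim_capped : capped trim.
Proof.
have key n : forall t x, wedge t x -> x < 2 ^+ n -> trim t x <= cap x.
  elim: n => [|n IH] t x D xn; rewrite /trim D; first exact: mild_le_cap.
  have [x1|x1] := ltP x 1; first exact: mild_le_cap.
  have /wedgeP[/andP[t1 tT] /andP[x0 xt]] := D.
  have xT : 1 <= x <= T by rewrite x1 (le_trans xt).
  rewrite (le_trans _ (cap_half x1))// -lee_fin (le_trans (mild_le_newborn D x1))//.
  apply: mild_newborn_le => // y /andP[y0 yx].
  have D' : wedge x y by apply/wedgeP; rewrite xT y0; split => //; lra.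
  apply: le_trans (cap_mono yx); apply: IH => //.
  by rewrite exprS in xn; lra.
move=> t x D; apply: (key (Num.bound x)) => //.
have /wedgeP[_ /andP[x0 _]] := D.
rewrite (lt_le_trans (archi_boundP x0))// -natrX ler_nat ltnW//.
exact: ltn_expl.
Qed.

(** A continuous function on a compact interval attains its minimum, and N is
    positive everywhere by assumption. *)
Lemma trim_population : exists2 nu, 0 < nu & forall t, 1 <= t <= T -> nu <= population trim t.
Proof.
(* the projection onto [1, T], which makes N continuous on the whole line *)
pose c (t : R) : R := Num.max 1 (Num.min t T).
have cT t : 1 <= c t <= T.
  by rewrite /c le_max lexx/= ge_max (ltW T_gt1)/= ge_min lexx orbT.
have cf : continuous (fun t => population trim (c t)).
  move=> t; apply: (@cvg_seqP _ (fun t => population trim (c t))) => u ut.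
  apply: population_cvg; [exact: trim_regular|exact: trim_capped|exact: nearW| exact: cT|].
  apply: (continuous_cvg _ _ ut); rewrite /c.
  by apply: continuous_max; [exact: cvg_cst|apply: continuous_min; [exact: cvg_id|exact: cvg_cst]].
have [s _ hs] := EVT_min (ltW T_gt1) (continuous_subspaceT cf).
exists (population trim (c s)).
  have [_ hN _] := mh; have [/andP[N0 _] _] := hN _ (cT s).
  by rewrite -lte_fin -(N_population trim_regular trim_capped trim_Omega).
move=> t tT; have -> : t = c t.
  by rewrite /c; have [t1 tT'] := andP tT; rewrite min_l// max_r.
by apply: hs; rewrite in_itv.
Qed.

Section MildN.
Variable nu : R.
Hypotheses (nu0 : 0 < nu) (hnu : forall t, 1 <= t <= T -> nu <= population trim t).

Lemma trim_fixed t x : wedge t x -> (x = 0 -> diag_cont trim) -> trim t x = evolve trim t x.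
Proof.
move=> D dg; have [_ _ hG] := mh.
have := Gamma_evolve trim_regular trim_capped nu0 hnu trim_Omega D dg.
by rewrite (hG _ _ (wedge_Omega D)) (trim_Omega (wedge_Omega D)) => -[].
Qed.

(** Membership in X says nothing about the diagonal. Near it, at sizes above 1,
    the equation reads h(t, x) = B(x) e^{-E} with B continuous and E of order
    t - x. *)
Lemma trim_diag_cont : diag_cont trim.
Proof.
move=> t /andP[t1 tT] u v uvD ut vt.
have pc := trim_regular; have cc := trim_capped.
have tT' : 1 <= t <= T by rewrite tT ltW.
have D : wedge t t by apply/wedgeP; rewrite tT' lexx (le_trans _ (ltW t1)).
have v1 : \forall n \near \oo, 1 < v n by exact: cvgr_gt vt _ t1.
have bE n : wedge (u n) (v n) -> 1 < v n ->
    loss trim (u n) (v n) <= k0 * (cap T / nu * (u n - v n)).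
  move=> /wedgeP[_ /andP[_ vu]] vn1; apply: loss_le => //; last by rewrite lexx.
  by move=> v0; move: vn1; rewrite v0 ltNge ler01.
have E0 : loss trim (u n) (v n) @[n --> \oo] --> (0 : R).
  apply: (@squeeze_cvgr _ _ _ _ (fun=> 0) (fun n => k0 * (cap T / nu * (u n - v n)))).
  - near=> n; rewrite loss_ge0//= bE//; near: n => //.
  - exact: cvg_cst.
  - rewrite -[X in _ --> X](mulr0 k0); apply: cvgMr.
    rewrite -[X in _ --> X](mulr0 (cap T / nu)); apply: cvgMr.
    by rewrite -[X in _ --> X](subrr t); exact: cvgB.
have Ett : loss trim t t = 0.
  apply/le_anti; rewrite loss_ge0// andbT.
  rewrite (le_trans (loss_le (a := t) pc cc nu0 hnu _ _ _))// ?lexx// ?subrr ?mulr0//.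
  by move=> t0; move: t1; rewrite t0 ltNge ler01.
rewrite trim_fixed//; last by move=> t0; move: t1; rewrite t0 ltNge ler01.
rewrite /evolve D /source ltNge (ltW t1)/= Ett.
have : newborn trim (v n) * expR (- loss trim (u n) (v n)) @[n --> \oo] --> newborn trim t * expR (- 0).
  apply: cvgM.
    apply: newborn_cvg => //; first by apply: lt_le_trans nu0 (hnu tT').
    near=> n; have /wedgeP[/andP[_ uT] /andP[_ vu]] : wedge (u n) (v n) by near: n.
    by rewrite (le_trans vu uT) andbT ltW//; near: n.
  by apply: continuous_cvg; [exact: continuous_expR|exact: cvgN].
apply: cvg_trans; apply: near_eq_cvg; near=> n.
have Dn : wedge (u n) (v n) by near: n.
have vn1 : 1 < v n by near: n.
rewrite trim_fixed//; last by move=> v0; move: vn1; rewrite v0 ltNge ler01.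
by rewrite /evolve Dn /source ltNge (ltW vn1).
Unshelve. all: by end_near. Qed.

Lemma trim_admissible : admissible nu trim.
Proof. by split; [exact: trim_regular|exact: trim_capped|exact: trim_diag_cont|]. Qed.

End MildN.

Lemma mild_admissible : exists nu, 0 < nu /\ admissible nu trim /\
  forall t x, wedge t x -> trim t x = evolve trim t x.
Proof.
have [nu nu0 hnu] := trim_population; exists nu; split => //; split; first exact: trim_admissible.
by move=> t x D; apply: (trim_fixed nu0 hnu D) => _; exact: trim_diag_cont hnu.
Qed.

End Mild.

Lemma admissible_weaken nu nu' g : nu' <= nu -> admissible nu g -> admissible nu' g.
Proof.
by move=> h [pg cg dg gN]; split => // t /gN; exact: le_trans.
Qed.

(** * Existence and uniqueness *)

(** The lower bounds of the two populations may differ; the contraction is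
    applied with the smaller one. *)
Theorem mild_exists_unique : exists g : R * R -> R,
  mild_solution k0 gini T g /\
  forall h : R * R -> R, mild_solution k0 gini T h ->
    forall p, Omega T p -> h p = g p.
Proof.
have [g [ag fg]] := evolve_fixed_exists.
exists (fun p => g p.1 p.2); split; first exact: fixed_mild.
move=> h mh [t x] O /=; have [nu [nu0 [ah fh]]] := mild_admissible mh.
rewrite (trim_Omega mh O).
have [D|D] := boolP (wedge t x); last by rewrite (regular_out (admissible_regular ag) D) (regular_out (trim_regular mh) D).
apply: (@evolve_fixed_unique (Num.min nu pop_floor) _ _ _ _ _ fh (fun s y _ => fg s y) t x D).
- by rewrite lt_min nu0 pop_floor_gt0.
- by apply: admissible_weaken ah; rewrite ge_min lexx.
- by apply: admissible_weaken ag; rewrite ge_min lexx orbT.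
Qed.

End Model.

Unset Implicit Arguments.

(** The two bounds on the initial density are its extreme values on the compact
    interval [0, 1], and its minimum is positive. *)
Theorem theorem1 (R : realType) (k0 : R) (gini : R -> R) (T : R)
    (k0_gt0 : 0 < k0)
    (gini_cont : {within `[0, 1], continuous gini})
    (gini_gt0 : forall x, 0 <= x <= 1 -> 0 < gini x)
    (gini_mass : (\int[lebesgue_measure]_(x in `[0%R, 1%R])
                    (x * gini x)%:E = 1)%E)
    (T_gt1 : 1 < T) :
  exists g : R * R -> R,
    mild_solution k0 gini T g /\
    forall h : R * R -> R, mild_solution k0 gini T h ->
      forall p, Omega T p -> h p = g p.
Proof.
have [c c01 hc] := EVT_min (@ler01 R) gini_cont.
have [d d01 hd] := EVT_max (@ler01 R) gini_cont.
rewrite in_itv/= in c01; rewrite in_itv/= in d01.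
apply: (@mild_exists_unique R k0 T (gini d) k0_gt0 T_gt1 (gini_gt0 d d01) gini
  (gini c) (gini_gt0 c c01) gini_cont) => x x01.
- by apply: hc; rewrite in_itv.
- by apply: hd; rewrite in_itv.
Qed.
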